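(* Let $w\in\mathrm{Gr}_{\mathcal H_+}(\mathcal H)$ and $\mathbf n'\in\mathbf B$. For integers $p\ge 0$ put $\boldsymbol\gamma_p:=\boldsymbol\alpha_p-\boldsymbol\alpha_{-p-1}$ ($=\boldsymbol\beta_{p+1}$), and abbreviate $H:=H^{\mathbf n'}_w$, $H_{\mathbf v}:=H^{\mathbf n'+\mathbf v}_w$, $H^{(p|q)}:=H^{\mathbf n',(p|q)}_w$, $H^{(p|q)}_{\mathbf v}:=H^{\mathbf n'+\mathbf v,(p|q)}_w$ for $\mathbf v\in\mathbf B$. Then for every triple of integers $0\le i<j<k$, writing $P:=H_{\boldsymbol\gamma_i}H_{\boldsymbol\gamma_j}H_{\boldsymbol\gamma_k}$, $X:=H^{(i|j)}H^{(j|k)}H^{(k|i)}$, $X^T:=H^{(j|i)}H^{(k|j)}H^{(i|k)}$, the following hold in $(S^\times_{\mathbf x})^{-1}\mathbb C[[\mathbf x,\mathbf t]]$: (1) $H H^{(j|k)}H^{(k|j)}_{\boldsymbol\gamma_i}=-HH_{\boldsymbol\gamma_i}H_{\boldsymbol\gamma_j+\boldsymbol\gamma_k}+P-X$; (2) $H H^{(k|i)}H^{(i|k)}_{\boldsymbol\gamma_j}=HH_{\boldsymbol\gamma_j}H_{\boldsymbol\gamma_i+\boldsymbol\gamma_k}-P+X$; (3) $H H^{(i|j)}H^{(j|i)}_{\boldsymbol\gamma_k}=-HH_{\boldsymbol\gamma_k}H_{\boldsymbol\gamma_i+\boldsymbol\gamma_j}+P-X$; (4) $H H^{(k|j)}H^{(j|k)}_{\boldsymbol\gamma_i}=-HH_{\boldsymbol\gamma_i}H_{\boldsymbol\gamma_j+\boldsymbol\gamma_k}+P-X^T$;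 (5) $H H^{(i|k)}H^{(k|i)}_{\boldsymbol\gamma_j}=HH_{\boldsymbol\gamma_j}H_{\boldsymbol\gamma_i+\boldsymbol\gamma_k}-P+X^T$; (6) $H H^{(j|i)}H^{(i|j)}_{\boldsymbol\gamma_k}=-HH_{\boldsymbol\gamma_k}H_{\boldsymbol\gamma_i+\boldsymbol\gamma_j}+P-X^T$; (7) $H^2X H_{\boldsymbol\gamma_i+\boldsymbol\gamma_j+\boldsymbol\gamma_k}=X^2-X\big(2P-H(H_{\boldsymbol\gamma_i}H_{\boldsymbol\gamma_j+\boldsymbol\gamma_k}+H_{\boldsymbol\gamma_j}H_{\boldsymbol\gamma_i+\boldsymbol\gamma_k}+H_{\boldsymbol\gamma_k}H_{\boldsymbol\gamma_i+\boldsymbol\gamma_j})\big)+(H_{\boldsymbol\gamma_i}H_{\boldsymbol\gamma_j}-HH_{\boldsymbol\gamma_i+\boldsymbol\gamma_j})(H_{\boldsymbol\gamma_i}H_{\boldsymbol\gamma_k}-HH_{\boldsymbol\gamma_i+\boldsymbol\gamma_k})(H_{\boldsymbol\gamma_j}H_{\boldsymbol\gamma_k}-HH_{\boldsymbol\gamma_j+\boldsymbol\gamma_k})$.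
   Context: Partitions and Frobenius notation: a partition $\lambda$ of Frobenius rank $r$ is written $\lambda=(a_1,\dots,a_r\mid b_1,\dots,b_r)$ with $a_1>\dots>a_r\ge 0$, $b_1>\dots>b_r\ge 0$, $a_i=\lambda_i-i$, $b_i=\lambda'_i-i$; $(p|q)$ is a hook. Points and $\tau$-functions: a point $w\in\mathrm{Gr}_{\mathcal H_+}(\mathcal H)$ is a family $(\pi_\lambda(w))_\lambda$ of complex numbers indexed by all partitions, not all zero, satisfying all Plücker relations (for all $0<k<N$, all $(k-1)$-tuples $I$ and $(k+1)$-tuples $J$ in $\{-k,\dots,N-k-1\}$: $\sum_{j=1}^{k+1}(-1)^j\tilde\pi_{I_1..I_{k-1}J_j}(w)\tilde\pi_{J_1..\widehat{J_j}..J_{k+1}}(w)=0$, where $\tilde\pi_L(w)=\mathrm{sgn}(L)\pi_{\lambda(L)}(w)$, $\mathrm{sgn}(L)$ the sign of the sorting permutation (0 if repeated entries) and $\lambda(L)_i=L'_{k-i+1}+i$ for the sorted $L'_1<\dots<L'_k$). Its KP $\tau$-function is $\tau_w(\mathbf t)=\sum_\lambda\pi_\lambda(w)s_\lambda(\mathbf t)\in\mathbb C[[\mathbf t]]$, with $s_\lambda$ the Schur function written in $t_i=p_i/i$. $\mathbb C[[\mathbf x,\mathbf t]]$ is the ring of formal power series in $x_i$ ($i\in\mathbb Z$), $t_j$ ($j\ge1$), and $(S^\times_{\mathbf x})^{-1}\mathbb C[[\mathbf x,\mathbf t]]$ its localization at the $x_i-x_j$, $i\ne j$; $f(\mathbf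 t+\sum_in_i[x_i])$ denotes the substitution $t_j\mapsto t_j+\sum_in_ix_i^j/j$. $\mathbf A$ is the group of finitely supported integer sequences $(n_i)_{i\in\mathbb Z}$, $\boldsymbol\alpha_i$ the unit vectors. $H^{\mathbf n}_w:=\prod_{i<j}(x_i-x_j)^{n_in_j}\tau_w(\mathbf t+\sum_in_i[x_i])$ and $H^{\mathbf n,\lambda}_w:=H_w^{\mathbf n+\sum_{i=1}^r\boldsymbol\alpha_{a_i}-\sum_{i=1}^r\boldsymbol\alpha_{-b_i-1}}$. $\mathbf B\subset\mathbf A$ is the sublattice of $\mathbf n$ with $n_{i-1}=-n_{-i}$ for all $i\ge1$, generated by $\boldsymbol\beta_i:=\boldsymbol\alpha_{i-1}-\boldsymbol\alpha_{-i}$, $i\ge1$. *)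

(* Defs.v *)
From HB Require Import structures.
From mathcomp Require Import all_boot all_order all_algebra all_fingroup.
From mathcomp Require Import finmap complex Rstruct.
From Stdlib Require Import ClassicalEpsilon.
Set Implicit Arguments. Unset Strict Implicit. Unset Printing Implicit Defensive.
Import Order.TTheory GRing.Theory Num.Theory.
Local Open Scope ring_scope.
Local Open Scope fset_scope.
Local Open Scope ring_scope.

Definition C : numClosedFieldType := (Rdefinitions.R)[i].

(** * The ring C[[x,t]] of formal power series in x_i (i in Z), t_j (j >= 1).
    Variable [inl i] is x_i, variable [inr j] is t_(j+1).  A monomial is a
    finitely supported exponent map; a series is an arbitrary coefficient
    function on monomials. *)
Definition var : Type := (int + nat)%type.
Definition xv (i : int) : var := inl i.
Definition tv (j : nat) : var := inr j.-1.   (* t_j, for j >= 1 *)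

Definition mono : Type := {fsfun var -> nat with 0%N}.
Definition ser : Type := mono -> C.

Definition mk_mono (S : {fset var}) (h : S -> nat) : mono :=
  [fsfun x : S => h x | 0%N].
Definition mono0 : mono := [fsfun x in (fset0 : {fset var}) => 0%N | 0%N].
Definition monoV (v : var) : mono := [fsfun x in [fset v] => 1%N | 0%N].

Definition sadd (f g : ser) : ser := fun m => f m + g m.
Definition sopp (f : ser) : ser := fun m => - f m.
Definition sscale (c : C) (f : ser) : ser := fun m => c * f m.
Definition sC (c : C) : ser := fun m => if m == mono0 then c else 0.
Definition sV (v : var) : ser := fun m => if m == monoV v then 1 else 0.

(** Cauchy product: the coefficient of m is the (finite) sum over all
    factorisations m = d * e of monomials; d is encoded by its exponents
    on the support of m. *)
Definition smul (f g : ser) : ser := fun m =>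
  let S := finsupp m in
  let N := (\max_(s : S) m (val s))%N in
  \sum_(d : {ffun S -> 'I_N.+1} | [forall s, (d s <= m (val s))%N])
     f (mk_mono (fun s => nat_of_ord (d s))) *
     g (mk_mono (fun s => m (val s) - d s)%N).

Definition ssum (l : seq ser) : ser := foldr sadd (sC 0) l.
Definition sprod (l : seq ser) : ser := foldr smul (sC 1) l.
Definition spow (f : ser) (n : nat) : ser := sprod (nseq n f).

(** * Schur functions in the variables t_j = p_j / j, evaluated at a family
    T = (T_j)_{j>=1} of series. *)
(** h_k(T) = coefficient of z^k in exp(sum_{j>=1} T_j z^j)
           = sum_{m : sum_j j m_j = k} prod_j T_j^{m_j} / m_j! *)
Definition hT (T : nat -> ser) (k : nat) : ser := fun m =>
  \sum_(mu : {ffun 'I_k -> 'I_k.+1} | (\sum_(a < k) a.+1 * mu a == k)%N)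
     sprod [seq sscale ((mu a)`!%:R)^-1 (spow (T a.+1) (mu a)) | a : 'I_k <- enum 'I_k] m.
Definition hZ (T : nat -> ser) (z : int) : ser :=
  match z with Posz k => hT T k | Negz _ => sC 0 end.
(** Jacobi--Trudi: s_lam = det (h_{lam_a - a + b})_{a,b}, via Leibniz. *)
Definition schurT (T : nat -> ser) (lam : seq nat) : ser := fun m =>
  \sum_(s : 'S_(size lam))
    (-1) ^+ odd_perm s *
    sprod [seq hZ T ((nth 0%N lam a)%:Z - (nat_of_ord a)%:Z + (nat_of_ord (s a))%:Z)
          | a : 'I_(size lam) <- enum 'I_(size lam)] m.

Definition is_partition (l : seq nat) : bool :=
  sorted geq l && all (fun x => 0 < x)%N l.

(** sign of the sorting permutation of L (0 if L has repeated entries) *)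
Definition sgnL (L : seq int) : C :=
  if uniq L then
    (-1) ^+ (\sum_(a < size L) \sum_(b < size L | (a < b)%N)
               nat_of_bool (nth (0:int) L b < nth (0:int) L a)%R)%N
  else 0.
(** lam(L)_i = L'_{k-i+1} + i for L' = L sorted increasingly (zero parts
    dropped, so that the result is a partition) *)
Definition lamL (L : seq int) : seq nat :=
  let k := size L in
  let L' := sort (fun a b : int => a <= b) L in
  filter (fun x => 0 < x)%N
    [seq absz (nth 0 L' (k - i.+1) + (i.+1)%:Z) | i <- iota 0 k].
Definition pitilde (pi : seq nat -> C) (L : seq int) : C := sgnL L * pi (lamL L).

Definition in_range (k N : nat) (x : int) : bool :=
  (- (k%:Z) <= x) && (x <= N%:Z - k%:Z - 1).

Definition plucker (pi : seq nat -> C) : Prop :=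
  forall (N k : nat), (0 < k < N)%N ->
  forall I J : seq int, size I = k.-1 -> size J = k.+1 ->
    all (in_range k N) I -> all (in_range k N) J ->
    \sum_(j < k.+1) (-1) ^+ j.+1 * pitilde pi (rcons I (nth 0 J j))
                   * pitilde pi (take j J ++ drop j.+1 J) = 0.

(** A point w of Gr is its family of Plucker coordinates (pi_lam(w))_lam,
    indexed by partitions (values at non-partitions are irrelevant). *)
Definition is_point (pi : seq nat -> C) : Prop :=
  (exists lam, is_partition lam /\ pi lam != 0) /\ plucker pi.

Definition Avec : Type := {fsfun int -> int with 0}.
Definition aadd (n m : Avec) : Avec :=
  [fsfun x in finsupp n `|` finsupp m => n x + m x | 0].
Definition aopp (n : Avec) : Avec := [fsfun x in finsupp n => - n x | 0].
Definition alpha (p : int) : Avec := [fsfun x in [fset p] => 1 | 0].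
Definition gamma (p : nat) : Avec := aadd (alpha p%:Z) (aopp (alpha (- p%:Z - 1))).
Definition inB (n : Avec) : Prop :=
  forall i : nat, (0 < i)%N -> n (i%:Z - 1) = - n (- i%:Z).

Definition Tshift (n : Avec) (j : nat) : ser :=
  sadd (sV (tv j))
    (ssum [seq sscale ((n i)%:~R / j%:R) (spow (sV (xv i)) j)
          | i <- enum_fset (finsupp n)]).

(** partial sums of sum_lam pi_lam s_lam(T), over partitions with at most
    N parts, all <= N (padded with zeros to N-tuples); these exhaust all
    partitions as N grows. *)
Definition tau_partial (pi : seq nat -> C) (T : nat -> ser) (N : nat) : ser :=
  fun m =>
  \sum_(s : N.-tuple 'I_N.+1 | sorted geq [seq nat_of_ord x | x <- s])
     pi (filter (fun x => 0 < x)%N [seq nat_of_ord x | x <- s]) *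
     schurT T (filter (fun x => 0 < x)%N [seq nat_of_ord x | x <- s]) m.

Definition ev_lim (a : nat -> C) : C :=
  epsilon (inhabits 0) (fun c => exists N, forall M, (N <= M)%N -> a M = c).

(** tau_w(t + sum_i n_i [x_i]) = sum_lam pi_lam(w) s_lam(t + sum_i n_i[x_i]),
    the infinite sum taken coefficientwise in the formal topology *)
Definition tau_shift (pi : seq nat -> C) (n : Avec) : ser :=
  fun m => ev_lim (fun N => tau_partial pi (Tshift n) N m).

(** * The localization (S_x^x)^{-1} C[[x,t]].
    An element is a pair (a, D) standing for a / prod_{(i,j) in D} (x_i - x_j). *)
Definition xdiff (i j : int) : ser := sadd (sV (xv i)) (sopp (sV (xv j))).
Definition den (D : seq (int * int)) : ser := sprod [seq xdiff p.1 p.2 | p <- D].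
Definition frac : Type := (ser * seq (int * int))%type.

Definition fmul (a b : frac) : frac := (smul a.1 b.1, a.2 ++ b.2).
Definition fadd (a b : frac) : frac :=
  (sadd (smul a.1 (den b.2)) (smul b.1 (den a.2)), a.2 ++ b.2).
Definition fopp (a : frac) : frac := (sopp a.1, a.2).

(** equality in the localization: a/s = b/s' iff u (a s' - b s) = 0 for some
    u in the multiplicative set generated by the x_i - x_j, i <> j *)
Definition loc_eq (a b : frac) : Prop :=
  exists U : seq (int * int), all (fun p => p.1 != p.2) U /\
    smul (den U) (sadd (smul a.1 (den b.2)) (sopp (smul b.1 (den a.2)))) = sC 0.

Declare Scope loc_scope.
Delimit Scope loc_scope with loc.
Notation "a + b" := (fadd a b) : loc_scope.
Notation "a * b" := (fmul a b) : loc_scope.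
Notation "- a" := (fopp a) : loc_scope.
Notation "a - b" := (fadd a (fopp b)) : loc_scope.
Notation "a =~ b" := (loc_eq a b) (at level 70, no associativity).

(** * H^n_w = prod_{i<j} (x_i - x_j)^{n_i n_j} tau_w(t + sum_i n_i [x_i]) *)
Definition supp_pairs (n : Avec) : seq (int * int) :=
  let s := enum_fset (finsupp n) in
  [seq (p.1, p.2) | p <- [seq (a, b) | a <- s, b <- s] & p.1 < p.2].

Definition Hn (pi : seq nat -> C) (n : Avec) : frac :=
  (smul (sprod [seq spow (xdiff p.1 p.2) (absz (n p.1 * n p.2))
               | p <- supp_pairs n & 0 <= n p.1 * n p.2])
        (tau_shift pi n),
   flatten [seq nseq (absz (n p.1 * n p.2)) p
           | p <- supp_pairs n & n p.1 * n p.2 < 0]).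

(** H^{n,lam}_w for lam = (a_1..a_r | b_1..b_r) in Frobenius notation *)
Definition Hfrob (pi : seq nat -> C) (n : Avec) (a b : seq nat) : frac :=
  Hn pi (foldr aadd n
          ([seq alpha x%:Z | x <- a] ++ [seq aopp (alpha (- x%:Z - 1)) | x <- b])).
Definition Hhook (pi : seq nat -> C) (n : Avec) (p q : nat) : frac :=
  Hfrob pi n [:: p] [:: q].

(* Main.v *)
Require Import Defs.
From HB Require Import structures.
From mathcomp Require Import all_boot all_order all_algebra all_fingroup.
From mathcomp Require Import finmap zify ring boolp.
From Stdlib Require Import ClassicalEpsilon.
Set Implicit Arguments. Unset Strict Implicit. Unset Printing Implicit Defensive.
Import Order.TTheory GRing.Theory Num.Theory.
Local Open Scope fset_scope.
Local Open Scope ring_scope.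

(** The Plücker relations are multilinear in the basis vectors, so the form
    with coefficients pi_L satisfies them at arbitrary vectors.  Evaluated at
    the columns (h_{l+b}(T))_l this form is tau(T), truncated to a k x k box
    of partitions.  Since h_n(T+[x]) - x h_{n-1}(T+[x]) = h_n(T), column
    operations give
      (x-y)(x-z)(y-z) tau(T+[x]+[y]+[z]) = form(v(x), v(y), v(z), fixed columns),
    exactly for every k >= 3, so the left-hand sides satisfy the Plücker
    relations of 3-element subsets.  Coefficientwise stabilisation (tau is
    graded) passes this to the full tau-function.

    With n0 = n' - alpha_{-i-1} - alpha_{-j-1} - alpha_{-k-1}, every series in
    the theorem is H^{n0 + alpha_a + alpha_b + alpha_c} for three of the six
    indices involved, and differs from the expression above by a factor
    multiplicative in {a,b,c}.  Hence the hooks form a 3 x 3 matrix whose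
    minors are, up to powers of H, the other series. *)

(** * The ring of formal power series *)

Local Opaque C.

(** The Plücker relations speak of finite index tuples, whereas a tau-function is an infinite sum.
    Inside a square box the sum becomes a finite alternating form, and the passage to the limit
    happens only after the relation has been proved there. The six indices a and -a-1 with a in {i,
    j, k} have twenty 3-subsets, and these correspond exactly to the twenty series of the theorem.
    Two obstacles shape the last steps. The exponents of the differences x_p - x_q may be negative,
    and no cancellation of such differences in the ring of series is available. All twenty series
    are therefore written over one common denominator, and equality in the localization is witnessed
    by a power of it. This works because the two sides of each identity have the same degree in the
    factors H, so that every term carries the same power of the denominator. *)

Lemma mk_monoE (S : {fset var}) (h : S -> nat) (v : var) :
  mk_mono h v = if insub v is Some s then h s else 0%N.
Proof. by rewrite /mk_mono fsfun_ffun; case: insubP. Qed.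

Lemma mk_mono_val (S : {fset var}) (h : S -> nat) (s : S) : mk_mono h (val s) = h s.
Proof. by rewrite mk_monoE valK. Qed.

Lemma mono0E v : mono0 v = 0%N.
Proof. by rewrite fsfunE inE. Qed.

Lemma monoVE v w : monoV v w = (w == v) :> nat.
Proof. by rewrite fsfunE inE; case: eqP. Qed.

Lemma monoP (m m' : mono) : (forall v, m v = m' v) -> m = m'.
Proof. by move=> E; apply/fsfunP. Qed.

Definition mle (d m : mono) : Prop := forall v, (d v <= m v)%N.
Definition madd (d m : mono) : mono :=
  [fsfun v in finsupp d `|` finsupp m => (d v + m v)%N | 0%N].
Definition msub (m d : mono) : mono := [fsfun v in finsupp m => (m v - d v)%N | 0%N].

Lemma maddE d m v : madd d m v = (d v + m v)%N.
Proof.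
rewrite fsfunE inE; case: ifP => // /negbT; rewrite negb_or => /andP[].
by rewrite !memNfinsupp => /eqP-> /eqP->.
Qed.

Lemma msubE m d v : msub m d v = (m v - d v)%N.
Proof.
by rewrite fsfunE; case: ifP => // /negbT; rewrite memNfinsupp => /eqP->.
Qed.

(** The index set of [smul] as a list of monomials: identities between convolutions become [perm_eq]
    statements about lists of divisors. *)
Definition divs (m : mono) : seq mono :=
  let T := {ffun finsupp m -> 'I_(\max_(s : finsupp m) m (val s)).+1} in
  [seq mk_mono (fun s => nat_of_ord (d s)) |
   d : T in [pred d : T | [forall s, (d s <= m (val s))%N]]].

Lemma divs_uniq m : uniq (divs m).
Proof.
rewrite map_inj_uniq ?enum_uniq // => d d' E; apply/ffunP => s; apply: val_inj.
by move: (congr1 (fun f : mono => f (val s)) E); rewrite !mk_mono_val.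
Qed.

Lemma mem_divs m d : reflect (mle d m) (d \in divs m).
Proof.
apply: (iffP imageP) => [[f]|le].
  rewrite inE => /forallP le -> v; rewrite mk_monoE.
  by case: insubP => // s _ <-; apply: le.
have lt (s : finsupp m) : (d (val s) < (\max_(s : finsupp m) m (val s)).+1)%N.
  by rewrite ltnS; apply: leq_trans (le _) _;
    apply: (leq_bigmax (F := fun s : finsupp m => m (val s)) s).
exists [ffun s => Ordinal (lt s)].
  by rewrite inE; apply/forallP => s; rewrite ffunE /=; apply: le.
apply: monoP => v; rewrite mk_monoE; case: insubP => [s _ <-|].
  by rewrite ffunE.
by rewrite memNfinsupp => /eqP m0; move: (le v); rewrite m0 leqn0 => /eqP.
Qed.

Lemma smulE f g m : smul f g m = \sum_(d <- divs m) f d * g (msub m d).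
Proof.
rewrite /smul /divs big_map big_enum_cond /=; apply: eq_big => [d|d _].
  by rewrite andbT.
congr (_ * g _); apply: monoP => v; rewrite msubE !mk_monoE.
by case: insubP => [s _ <- //|]; rewrite memNfinsupp => /eqP->.
Qed.

Local Opaque divs.

Lemma serP (f g : ser) : (forall m, f m = g m) -> f = g.
Proof. exact: funext. Qed.

Lemma saddA : associative sadd.
Proof. by move=> f g h; apply: serP => m; apply: addrA. Qed.
Lemma saddC : commutative sadd.
Proof. by move=> f g; apply: serP => m; apply: addrC. Qed.
Lemma sadd0 : left_id (sC 0) sadd.
Proof. by move=> f; apply: serP => m; rewrite /sadd /sC if_same add0r. Qed.
Lemma saddN : left_inverse (sC 0) sopp sadd.
Proof. by move=> f; apply: serP => m; rewrite /sadd /sC if_same; apply: addNr. Qed.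

Lemma msub_inv m d : mle d m -> msub m (msub m d) = d.
Proof. by move=> le; apply: monoP => v; rewrite !msubE subKn. Qed.

Lemma msub_le m d : mle (msub m d) m.
Proof. by move=> v; rewrite msubE leq_subr. Qed.

(** The involution d -> m/d permutes the divisors of m. *)
Lemma smulC : commutative smul.
Proof.
move=> f g; apply: serP => m; rewrite !smulE.
have /(perm_big _) -> /= : perm_eq (divs m) [seq msub m d | d <- divs m].
  apply: uniq_perm; rewrite ?divs_uniq //.
    rewrite map_inj_in_uniq ?divs_uniq // => d e /mem_divs dm /mem_divs em E.
    by rewrite -(msub_inv dm) E msub_inv.
  move=> d; apply/mem_divs/mapP => [dm|[e _ ->]]; last exact: msub_le.
  by exists (msub m d); rewrite ?msub_inv //; apply/mem_divs/msub_le.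
rewrite big_map; apply: eq_big_seq => d /mem_divs dm.
by rewrite msub_inv // mulrC.
Qed.

Lemma smulDl : left_distributive smul sadd.
Proof.
move=> f g h; apply: serP => m; rewrite /sadd !smulE -big_split /=.
by apply: eq_bigr => d _; rewrite mulrDl.
Qed.

Lemma msub0 m : msub m mono0 = m.
Proof. by apply: monoP => v; rewrite msubE mono0E subn0. Qed.

Lemma smulC1 (c : C) f m : smul (sC c) f m = c * f m.
Proof.
rewrite smulE (bigD1_seq mono0) ?divs_uniq //=; last first.
  by apply/mem_divs => v; rewrite mono0E.
rewrite /sC eqxx msub0 big1 ?addr0 // => d /negbTE ->; exact: mul0r.
Qed.

Lemma smul1 : left_id (sC 1) smul.
Proof. by move=> f; apply: serP => m; rewrite smulC1 mul1r. Qed.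

(** Both sides run over chains e | d | m; the substitution d = e d' lets d' run over the divisors of
    m/e. *)
Lemma smulA : associative smul.
Proof.
move=> f g h; apply: serP => m; rewrite [RHS]smulE.
have le_trans d e : mle e d -> mle d m -> mle e m.
  by move=> ed dm v; apply: leq_trans (ed v) (dm v).
transitivity (\sum_(d <- divs m) \sum_(e <- divs m | `[< mle e d >])
                f e * g (msub d e) * h (msub m d)); last first.
  apply: eq_big_seq => d /mem_divs dm; rewrite smulE mulr_suml -big_filter.
  apply: perm_big; apply: uniq_perm; rewrite ?filter_uniq ?divs_uniq // => e.
  rewrite mem_filter; apply/andP/mem_divs => [[/asboolP //]|ed].
  by split; [apply/asboolP | apply/mem_divs/(le_trans d)].
rewrite (exchange_big_dep xpredT) //= smulE; apply: eq_big_seq => e /mem_divs em.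
rewrite smulE mulr_sumr -big_filter.
have -> : \sum_(d <- [seq d <- divs m | `[< mle e d >]]) f e * g (msub d e) * h (msub m d)
   = \sum_(d <- [seq madd e d | d <- divs (msub m e)]) f e * g (msub d e) * h (msub m d).
  apply: perm_big; apply: uniq_perm; rewrite ?filter_uniq ?divs_uniq //.
    rewrite map_inj_uniq ?divs_uniq // => d d' E; apply: monoP => v.
    by move: (congr1 (fun f : mono => f v) E); rewrite !maddE => /addnI.
  move=> d; rewrite mem_filter; apply/andP/mapP => [[/asboolP ed /mem_divs dm]|].
    exists (msub d e); last by apply: monoP => v; rewrite maddE msubE subnKC.
    by apply/mem_divs => v; rewrite !msubE leq_sub2r.
  case=> d' /mem_divs dm ->; split.
    by apply/asboolP => v; rewrite maddE leq_addr.
  by apply/mem_divs => v; rewrite maddE -(subnKC (em v)) leq_add2l -msubE.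
rewrite [RHS]big_map; apply: eq_bigr => d _.
have -> : msub (madd e d) e = d by apply: monoP => v; rewrite msubE maddE addKn.
have -> : msub m (madd e d) = msub (msub m e) d.
  by apply: monoP => v; rewrite !msubE maddE subnDA.
by rewrite mulrA.
Qed.

Lemma sC1_neq0 : sC 1 <> sC 0.
Proof. by move/(congr1 (fun f : ser => f mono0)); rewrite /sC eqxx => /eqP; rewrite oner_eq0. Qed.

HB.instance Definition _ := gen_eqMixin ser.
HB.instance Definition _ := gen_choiceMixin ser.
HB.instance Definition _ := GRing.isZmodule.Build ser saddA saddC sadd0 saddN.

Lemma sC1_neq0b : sC 1 != 0 :> ser.
Proof. by apply/eqP; apply: sC1_neq0. Qed.

HB.instance Definition _ :=
  GRing.Zmodule_isComNzRing.Build ser smulA smulC smul1 smulDl sC1_neq0b.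

Lemma serD (f g : ser) m : (f + g) m = f m + g m. Proof. by []. Qed.
Lemma serN (f : ser) m : (- f) m = - f m. Proof. by []. Qed.
Lemma ser0 m : (0 : ser) m = 0. Proof. exact: if_same. Qed.
Lemma ser_sum I r (P : pred I) (F : I -> ser) m :
  (\sum_(i <- r | P i) F i) m = \sum_(i <- r | P i) F i m.
Proof. by elim/big_rec2: _ => [|i x y _ <-] //; apply: ser0. Qed.
Lemma serM (f g : ser) m : (f * g) m = \sum_(d <- divs m) f d * g (msub m d).
Proof. exact: smulE. Qed.
Lemma serZ c (f : ser) m : (sC c * f) m = c * f m.
Proof. exact: smulC1. Qed.
Lemma sscaleE c (f : ser) : sscale c f = sC c * f.
Proof. by apply: serP => m; rewrite serZ. Qed.

Lemma sC_is_zmod_morphism : zmod_morphism sC.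
Proof. by move=> a b; apply: serP => m; rewrite serD serN /sC; case: eqP; rewrite ?subr0. Qed.
Lemma sC_is_monoid_morphism : monoid_morphism sC.
Proof.
split=> // a b; apply: serP => m; rewrite serZ /sC; case: eqP => _ //.
by rewrite mulr0.
Qed.
HB.instance Definition _ := GRing.isZmodMorphism.Build C ser sC sC_is_zmod_morphism.
HB.instance Definition _ := GRing.isMonoidMorphism.Build C ser sC sC_is_monoid_morphism.

Lemma ssumE (l : seq ser) : ssum l = \sum_(f <- l) f.
Proof. by elim: l => [|f l IH]; rewrite ?big_nil ?big_cons //= IH. Qed.
Lemma sprodE (l : seq ser) : sprod l = \prod_(f <- l) f.
Proof. by elim: l => [|f l IH]; rewrite ?big_nil ?big_cons //= IH. Qed.
Lemma spowE (f : ser) n : spow f n = f ^+ n.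
Proof. by rewrite /spow sprodE big_nseq iter_mulr_1. Qed.

(** Characteristic zero, used in place of division: it makes Newton's recursion determine its
    solution, and it makes an alternating form vanish on a repeated argument. *)
Lemma ser_natmul_eq0 n (f : ser) : n.+1%:R * f = 0 -> f = 0.
Proof.
move=> E; apply: serP => m; move/(congr1 (fun f : ser => f m)): E.
rewrite -[n.+1%:R](rmorph_nat sC) serZ !ser0 => /eqP.
by rewrite mulf_eq0 pnatr_eq0 => /eqP.
Qed.

(** * Complete functions and the grading *)

Lemma hTE T k : hT T k =
  \sum_(mu : {ffun 'I_k -> 'I_k.+1} | (\sum_(a < k) a.+1 * mu a == k)%N)
     \prod_(a < k) (sC ((mu a)`!%:R)^-1 * T a.+1 ^+ mu a).
Proof.
apply: serP => m; rewrite ser_sum /hT; apply: eq_bigr => mu _.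
rewrite sprodE big_map big_enum.
by congr (_ m); apply: eq_bigr => a _; rewrite sscaleE spowE.
Qed.

(** * Newton's identity from truncated exponential series *)

Section TruncatedExp.
Variable T : nat -> ser.

Definition eqmod n (p q : {poly ser}) := forall i, (i <= n)%N -> p`_i = q`_i.

Lemma eqmod_refl n p : eqmod n p p. Proof. by []. Qed.
Lemma eqmodD n p q p' q' : eqmod n p p' -> eqmod n q q' -> eqmod n (p + q) (p' + q').
Proof. by move=> H K i le; rewrite !coefD H ?K. Qed.
Lemma eqmodM n p q p' q' : eqmod n p p' -> eqmod n q q' -> eqmod n (p * q) (p' * q').
Proof.
move=> H K i le; rewrite !coefM; apply: eq_bigr => j _.
by rewrite H ?K //; have := ltn_ord j; lia.
Qed.

Definition expc a m : ser := sC (m`!%:R)^-1 * T a.+1 ^+ m.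
(** The first [P] terms of exp(T_(a+1) z^(a+1)). The product [expprod] truncates exp(sum_j T_j z^j)
    both in the number of variables and in the number of terms. *)
Definition expp P a : {poly ser} := \sum_(m < P) expc a m *: 'X^(a.+1 * m)%N.
Definition expprod M P : {poly ser} := \prod_(a < M) expp P a.

Lemma coef_expp P a i :
  (expp P a)`_i = \sum_(m < P) expc a m * (i == (a.+1 * m)%N)%:R.
Proof. by rewrite coef_sum; apply: eq_bigr => m _; rewrite coefZ coefXn. Qed.

Lemma expp_stable n P a : (n < P)%N -> eqmod n (expp P a) (expp n.+1 a).
Proof.
move=> lt i le; rewrite !coef_expp.
rewrite (big_ord_widen (n1 := n.+1) P (fun m => expc a m * (i == (a.+1 * m)%N)%:R)) //.
rewrite [LHS](bigID (fun m : 'I_P => (m < n.+1)%N)) /= [X in _ + X]big1 ?addr0 //.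
by move=> m nm; rewrite (_ : _ == _ = false) ?mulr0 //; apply/negP => /eqP; nia.
Qed.

Lemma expp_eq1 n P a : (n <= a)%N -> eqmod n (expp P.+1 a) 1.
Proof.
move=> lt i le; rewrite coef_expp big_ord_recl big1 => [|m _].
  rewrite addr0 /=. rewrite muln0 coef1 /expc expr0 mulr1 fact0.  by rewrite invr1 rmorph1 mul1r.
by rewrite (_ : _ == _ = false) ?mulr0 //; apply/negP => /eqP; rewrite lift0; nia.
Qed.

Lemma expprod_stable n M P : (n <= M)%N -> (n < P)%N ->
  eqmod n (expprod M P) (expprod n n.+1).
Proof.
move=> nM nP; rewrite -(subnKC nM); elim: (M - n)%N => [|d IH].
  rewrite addn0 /expprod; elim/big_ind2: _ => [|p q r s|a _]; first exact: eqmod_refl.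
    exact: eqmodM.
  exact: expp_stable.
rewrite addnS /expprod big_ord_recr /= -[X in eqmod _ _ X]mulr1.
apply: eqmodM => //.
by case: P nP {IH} => // P nP; apply: expp_eq1; rewrite leq_addr.
Qed.

Lemma coef_expprod n : (expprod n n.+1)`_n = hT T n.
Proof.
rewrite hTE /expprod /expp bigA_distr_bigA coef_sum [RHS]big_mkcond.
apply: eq_bigr => mu _; rewrite scaler_prod -[X in _ *: X]expr_sum coefZ coefXn.
by rewrite eq_sym; case: eqP => _; rewrite ?mulr1 ?mulr0.
Qed.

Lemma expc_rec a m : m.+1%:R * expc a m.+1 = T a.+1 * expc a m.
Proof.
rewrite /expc factS natrM invfM rmorphM /= exprS.
have <- : sC (m.+1%:R) = m.+1%:R by apply: rmorph_nat.
have E : sC (m.+1%:R) * sC (m.+1%:R)^-1 = 1.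
  by rewrite -rmorphM /= mulfV ?rmorph1 // pnatr_eq0.
by rewrite !mulrA E; ring.
Qed.

(** The operator z d/dz multiplies exp(T z^(a+1)) by (a+1) T z^(a+1). The constant term dies, so one
    term of the truncation is lost. *)
Lemma deriv_expp P a :
  'X * (expp P.+1 a)^`() = (a.+1%:R * T a.+1) *: 'X^(a.+1) * expp P a.
Proof.
rewrite /expp raddf_sum /= mulr_sumr big_ord_recl /= muln0 expr0 derivZ.
rewrite derivC scaler0 mulr0 add0r mulr_sumr; apply: eq_bigr => m _.
rewrite /bump leq0n add1n derivZ derivXn -scalerAr -scaler_nat -!scalerAl -!scalerAr.
rewrite !scalerA -exprS -exprD; congr (_ *: 'X^_); last by lia.
by rewrite natrM -mulrA -expc_rec; ring.
Qed.

(** The logarithmic derivative, by the product rule. Starting from n+2 terms leaves n+1 after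
    differentiation, still enough up to degree n. *)
Lemma deriv_expprod n M : eqmod n ('X * (expprod M n.+2)^`())
  (\sum_(a < M) (a.+1%:R * T a.+1) *: 'X^(a.+1) * expprod M n.+2).
Proof.
elim: M => [|M IH]; first by rewrite /expprod !big_ord0 derivC mulr0.
rewrite big_ord_recr /= /expprod !big_ord_recr /= -/(expprod M n.+2).
rewrite derivM mulrDr; apply: eqmodD.
  rewrite mulrA; under eq_bigr do rewrite mulrA.
  rewrite -mulr_suml; exact: eqmodM IH (eqmod_refl _).
rewrite mulrCA deriv_expp mulrCA; apply: eqmodM; first exact: eqmod_refl.
apply: eqmodM; first exact: eqmod_refl.
by move=> i le; rewrite [RHS](expp_stable (n := n)) ?(expp_stable (n := n) (P := n.+2)).
Qed.

(** Newton's identity with power sums p_a = a T_a, read off as the coefficient of z^n in the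
    logarithmic derivative. *)
Lemma hT_newton n :
  n%:R * hT T n = \sum_(a < n) a.+1%:R * T a.+1 * hT T (n - a.+1).
Proof.
have := deriv_expprod n (leqnn n).
rewrite mulrC coefMX; case: n => [|n] E; first by rewrite big_ord0 mul0r.
move: E; rewrite /= coef_deriv (expprod_stable (n := n.+1)) // coef_expprod.
rewrite mulr_natl => ->; rewrite coef_sum; apply: eq_bigr => a _.
have lt := ltn_ord a.
rewrite -scalerAl coefZ coefXnM ltnNge lt /=; congr (_ * _).
by rewrite (expprod_stable (n := n.+1 - a.+1)) ?coef_expprod //; lia.
Qed.

Lemma hT0 : hT T 0 = 1.
Proof. by rewrite -coef_expprod /expprod big_ord0 coef1. Qed.

Lemma hT_unique (d : nat -> ser) : d 0%N = 1 ->
  (forall n, n.+1%:R * d n.+1 = \sum_(a < n.+1) a.+1%:R * T a.+1 * d (n - a)%N) ->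
  d =1 hT T.
Proof.
move=> d0 dS n; elim/ltn_ind: n => -[|n] IH; first by rewrite d0 hT0.
apply/eqP; rewrite -subr_eq0; apply/eqP/(@ser_natmul_eq0 n).
rewrite mulrBr dS hT_newton -sumrB big1 // => a _.
by rewrite IH ?subSS ?subrr //; lia.
Qed.

End TruncatedExp.

Section MiwaShift.
Variables (T T1 : nat -> ser) (x : ser).
Hypothesis shift : forall j, j.+1%:R * T1 j.+1 = j.+1%:R * T j.+1 + x ^+ j.+1.

Let d n : ser := if n is m.+1 then hT T1 m.+1 - x * hT T1 m else 1.

Let d_telescope m : \sum_(a < m.+1) x ^+ a.+1 * d (m - a) = x * hT T1 m.
Proof.
elim: m => [|m IH]; first by rewrite big_ord1 /= hT0.
rewrite big_ord_recl /= expr1.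
under eq_bigr do rewrite /= subSS exprS -mulrA.
by rewrite -mulr_sumr IH; ring.
Qed.

(* Multiplication of the generating series by 1 - x z undoes the shift t_j -> t_j + x^j/j. *)
Lemma hT_shift n : hT T1 n.+1 - x * hT T1 n = hT T n.+1.
Proof.
rewrite -[LHS]/(d n.+1); apply: hT_unique => // {}n.
transitivity (\sum_(a < n.+1) a.+1%:R * T1 a.+1 * d (n - a) - x * hT T1 n).
  rewrite /= mulrBr hT_newton big_ord_recr [in RHS]big_ord_recr /= subnn.
  have -> : n.+1%:R * (x * hT T1 n) = x * (n%:R * hT T1 n) + x * hT T1 n.
    by rewrite -natr1; ring.
  rewrite hT_newton mulr_sumr.
  have -> : \sum_(i < n) i.+1%:R * T1 i.+1 * d (n - i) =
     \sum_(i < n) i.+1%:R * T1 i.+1 * hT T1 (n.+1 - i.+1)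
     - \sum_(i < n) x * (i.+1%:R * T1 i.+1 * hT T1 (n - i.+1)).
    rewrite -sumrB; apply: eq_bigr => i _; have lt := ltn_ord i.
    rewrite subSS; have -> : (n - i = (n - i.+1).+1)%N by lia.
    by rewrite /=; ring.
  by rewrite /= subnn hT0; ring.
(* Written as a telescoping sum, x h_n removes exactly the summand x^(a+1) by which the power sums
   of [T1] exceed those of [T]. *)
rewrite -d_telescope -sumrB; apply: eq_bigr => a _; rewrite shift.
by ring.
Qed.

Lemma hZ_shift z : hZ T1 z - x * hZ T1 (z - 1) = hZ T z.
Proof.
case: z => [[|n]|n].
- by rewrite sub0r /= !hT0 (_ : sC 0 = 0) // mulr0 subr0.
- have -> : n.+1%:Z - 1 = n%:Z by rewrite intS addrAC subrr add0r.
  exact: hT_shift.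
- have -> : Negz n - 1 = Negz n.+1 by rewrite !NegzE (intS n.+1) opprD addrC.
  by rewrite [_ * _]mulr0 subr0.
Qed.
End MiwaShift.

(** With x_i of weight 1 and t_j of weight j, the argument t_j + sum_i n_i x_i^j / j is homogeneous
    of weight j. The constructor [inr j] stands for t_(j+1). *)
Definition vwt (v : var) : nat := match v with inl _ => 1%N | inr j => j.+1 end.
Definition wt (m : mono) : nat := (\sum_(v <- enum_fset (finsupp m)) vwt v * m v)%N.

Lemma wt_widen (S : {fset var}) (m : mono) : finsupp m `<=` S ->
  wt m = (\sum_(v <- enum_fset S) vwt v * m v)%N.
Proof.
move=> sub; rewrite /wt; apply: big_fset_incl => // v _ /=.
by rewrite memNfinsupp => /eqP->; rewrite muln0.
Qed.

Lemma finsupp_mle d m : mle d m -> finsupp d `<=` finsupp m.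
Proof.
move=> dm; apply/fsubsetP => v; rewrite !mem_finsupp -!lt0n => dv.
exact: leq_trans dv (dm v).
Qed.

Lemma wt_split m d : mle d m -> (wt d + wt (msub m d))%N = wt m.
Proof.
move=> dm; rewrite (wt_widen (finsupp_mle dm)) (wt_widen (finsupp_mle (@msub_le m d))).
rewrite -big_split; apply: eq_bigr => v _ /=.
by rewrite msubE -mulnDr subnKC.
Qed.

Lemma wt_mono0 : wt mono0 = 0%N.
Proof. by rewrite /wt big1 // => v _; rewrite mono0E muln0. Qed.

Lemma wt_monoV v : wt (monoV v) = vwt v.
Proof.
have sub : finsupp (monoV v) `<=` [fset v].
  by apply/fsubsetP => w; rewrite mem_finsupp monoVE in_fset1; case: (w == v).
by rewrite (wt_widen sub) big_seq_fset1 monoVE eqxx muln1.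
Qed.

(** The degree is an integer because Jacobi-Trudi entries h_z with z < 0 occur; a negative degree
    forces the series to vanish. *)
Definition homog (z : int) (f : ser) := forall m, f m != 0 -> (wt m)%:Z = z.

Lemma homog0 z : homog z 0.
Proof. by move=> m; rewrite ser0 eqxx. Qed.

Lemma homogC c : homog 0 (sC c).
Proof. by move=> m; rewrite /sC; case: (eqVneq m mono0) => [->|_]; rewrite ?eqxx ?wt_mono0. Qed.

Lemma homogV v : homog (vwt v)%:Z (sV v).
Proof. by move=> m; rewrite /sV; case: (eqVneq m (monoV v)) => [->|_]; rewrite ?eqxx ?wt_monoV. Qed.

Lemma homogD z f g : homog z f -> homog z g -> homog z (f + g).
Proof.
move=> hf hg m; case: (eqVneq (f m) 0) => [E|/hf //].
by rewrite serD E add0r; apply: hg.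
Qed.

Lemma homog_sum I r (P : pred I) z (F : I -> ser) :
  (forall i, P i -> homog z (F i)) -> homog z (\sum_(i <- r | P i) F i).
Proof. by move=> H; elim/big_ind: _ => //; [apply: homog0 | move=> f g; apply: homogD]. Qed.

Lemma homogM y z f g : homog y f -> homog z g -> homog (y + z) (f * g).
Proof.
move=> hf hg m; apply: contraNeq => ne; rewrite serM big1_seq // => d /andP[_ /mem_divs dm].
case: (eqVneq (f d) 0) => [->|/hf fd]; first by rewrite mul0r.
case: (eqVneq (g (msub m d)) 0) => [->|/hg gd]; first by rewrite mulr0.
by move: ne; rewrite -(wt_split dm) PoszD fd gd eqxx.
Qed.

Lemma homog_prod I r (P : pred I) (z : I -> int) (F : I -> ser) :
  (forall i, P i -> homog (z i) (F i)) ->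
  homog (\sum_(i <- r | P i) z i) (\prod_(i <- r | P i) F i).
Proof.
move=> H; elim/big_rec2: _ => [|i y f Pi]; first exact: homogC.
by move=> hf; apply: homogM; first exact: H.
Qed.

Lemma homogX z f n : homog z f -> homog (z * n%:Z) (f ^+ n).
Proof.
move=> hf; elim: n => [|n IH]; first by rewrite mulr0; apply: homogC.
by rewrite exprS intS mulrDr mulr1; apply: homogM.
Qed.

Definition graded (T : nat -> ser) := forall j, (0 < j)%N -> homog j%:Z (T j).

Lemma homog_hZ T z : graded T -> homog z (hZ T z).
Proof.
move=> gT; case: z => k; last exact: homog0.
rewrite /= hTE; apply: homog_sum => mu /eqP E.
rewrite -[X in homog X%:Z _]E (@big_morph _ _ Posz 0 +%R) //.
apply: homog_prod => a _; rewrite -[X in homog X _]add0r.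
by apply: homogM; [apply: homogC | rewrite PoszM; apply/homogX/gT].
Qed.

(** * Multilinear forms and Plücker relations *)

Section Multilinear.
Variables (R : comNzRingType) (r : seq int).
Implicit Types (F G : seq int -> R) (A B D vs : seq (int -> R)) (v w : int -> R).

(* The value at (v_1, ..., v_k) of the multilinear form on R^r whose
   coefficient at the basis vectors e_l, l \in L, is F L. *)
Fixpoint mlin F vs : R :=
  if vs is v :: vs' then \sum_(l <- r) v l * mlin (fun L => F (l :: L)) vs'
  else F [::].

Lemma eq_mlin F G vs :
  (forall L, size L = size vs -> all (fun l => l \in r) L -> F L = G L) ->
  mlin F vs = mlin G vs.
Proof.
elim: vs F G => [|v vs IH] F G FG /=; first exact: FG.
apply: eq_big_seq => l lr; congr (_ * _); apply: IH => L sL aL.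
by apply: FG; rewrite /= ?sL ?lr.
Qed.

Lemma mlinZ c F vs : mlin (fun L => c * F L) vs = c * mlin F vs.
Proof.
elim: vs F => [//|v vs IH] F /=; rewrite mulr_sumr.
by apply: eq_bigr => l _; rewrite IH; ring.
Qed.

Lemma mlin0 vs : mlin (fun=> 0) vs = 0.
Proof. by elim: vs => //= v vs IH; rewrite big1 // => l _; rewrite IH mulr0. Qed.

Lemma mlinD F G vs : mlin (fun L => F L + G L) vs = mlin F vs + mlin G vs.
Proof.
elim: vs F G => [//|v vs IH] F G /=; rewrite -big_split.
by apply: eq_bigr => l _; rewrite IH mulrDr.
Qed.

Lemma mlin_sum I (s : seq I) (F : I -> seq int -> R) vs :
  mlin (fun L => \sum_(i <- s) F i L) vs = \sum_(i <- s) mlin (F i) vs.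
Proof.
elim: s => [|i s IH].
  by rewrite big_nil -[RHS](mlin0 vs); apply: eq_mlin => L _ _; rewrite big_nil.
by rewrite big_cons -IH -mlinD; apply: eq_mlin => L _ _; rewrite big_cons.
Qed.

Lemma mlin_cat F A B : mlin F (A ++ B) = mlin (fun L => mlin (fun M => F (L ++ M)) B) A.
Proof. by elim: A F => [//|v A IH] F /=; apply: eq_bigr => l _; rewrite IH. Qed.

Lemma mlin_lin F A B v w u c : (forall l, u l = v l + c * w l) ->
  mlin F (A ++ u :: B) = mlin F (A ++ v :: B) + c * mlin F (A ++ w :: B).
Proof.
move=> E; rewrite !mlin_cat -mlinZ -mlinD; apply: eq_mlin => L _ _ /=.
by rewrite mulr_sumr -big_split; apply: eq_bigr => l _; rewrite E /=; ring.
Qed.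

Lemma mlin_scale F A B w u c : (forall l, u l = c * w l) ->
  mlin F (A ++ u :: B) = c * mlin F (A ++ w :: B).
Proof.
move=> E; rewrite !mlin_cat -mlinZ; apply: eq_mlin => L _ _ /=.
by rewrite mulr_sumr; apply: eq_bigr => l _; rewrite E /=; ring.
Qed.

(** Slot j is contracted with [g] and the other slots enter [F]. In a Plücker relation [g] is the
    other factor, with its last slot open. *)
Lemma mlin_del F (g : int -> R) vs j (v0 : int -> R) : (j < size vs)%N ->
  mlin (fun J => g (nth 0 J j) * F (take j J ++ drop j.+1 J)) vs =
  (\sum_(a <- r) nth v0 vs j a * g a) * mlin F (take j vs ++ drop j.+1 vs).
Proof.
elim: vs j F => [//|v vs IH] [|j] F lt /=.
  rewrite drop0 mulr_suml; apply: eq_bigr => l _.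
  rewrite -mulrA -[in RHS]mlinZ; congr (_ * _); apply: eq_mlin => L _ _.
  by rewrite drop0.
rewrite mulr_sumr; apply: eq_bigr => l _.
by rewrite (IH j (fun L => F (l :: L))) //; ring.
Qed.

Lemma mlin_plucker k F u vs (v0 : int -> R) :
  (forall I J, size I = k -> size J = k.+2 ->
    all (fun l => l \in r) I -> all (fun l => l \in r) J ->
    \sum_(j < k.+2) (-1) ^+ j * F (rcons I (nth 0 J j)) * F (take j J ++ drop j.+1 J) = 0) ->
  size u = k -> size vs = k.+2 ->
  \sum_(j < k.+2) (-1) ^+ j * mlin F (rcons u (nth v0 vs j))
                 * mlin F (take j vs ++ drop j.+1 vs) = 0.
Proof.
move=> Pl su sv; rewrite -[RHS](mlin0 u).
transitivity (mlin (fun I => mlin (fun J => \sum_(j < k.+2)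
   (-1) ^+ j * F (rcons I (nth 0 J j)) * F (take j J ++ drop j.+1 J)) vs) u); last first.
  apply: eq_mlin => I sI aI; rewrite -[RHS](mlin0 vs); apply: eq_mlin => J sJ aJ.
  by apply: Pl; rewrite ?sI ?sJ.
have E I : mlin (fun J => \sum_(j < k.+2)
   (-1) ^+ j * F (rcons I (nth 0 J j)) * F (take j J ++ drop j.+1 J)) vs =
   \sum_(j < k.+2) (-1) ^+ j * (\sum_(a <- r) nth v0 vs j a * F (rcons I a))
     * mlin F (take j vs ++ drop j.+1 vs).
  rewrite mlin_sum; apply: eq_bigr => j _.
  rewrite -mulrA -(@mlin_del F (fun a => F (rcons I a))) ?sv // -mlinZ.
  by apply: eq_mlin => J _ _; rewrite mulrA.
under (eq_mlin (F := fun I => mlin _ vs)) => I _ _ do rewrite E.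
rewrite mlin_sum; apply: eq_bigr => j _.
transitivity (mlin (fun I => (-1) ^+ j * mlin F (take j vs ++ drop j.+1 vs) *
    (\sum_(a <- r) nth v0 vs j a * F (rcons I a))) u).
  rewrite mlinZ -cats1 mlin_cat mulrAC; congr (_ * _ * _).
  by apply: eq_mlin => I _ _ /=; apply: eq_bigr => a _; rewrite cats1.
by apply: eq_mlin => I _ _; ring.
Qed.

Lemma mlin_tuple n (f : 'I_n -> int) F k (vs : seq (int -> R)) (v0 : int -> R) :
  r = [seq f i | i <- enum 'I_n] -> size vs = k ->
  mlin F vs = \sum_(L : k.-tuple 'I_n)
    F (map f L) * \prod_(b < k) nth v0 vs b (f (tnth L b)).
Proof.
move=> rE; elim: vs k F => [|v vs IH] k F <- /=.
  rewrite (bigD1 [tuple]) //= big_ord0 mulr1 big1 ?addr0 // => L /eqP nL.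
  by case: nL; apply: tuple0.
rewrite rE big_map big_enum /=.
under eq_bigr => i _ do rewrite (IH (size vs)) // mulr_sumr.
rewrite pair_big /=.
rewrite [RHS](reindex (fun p : 'I_n * (size vs).-tuple 'I_n => [tuple of p.1 :: p.2])) /=.
  apply: eq_bigr => [[i L] _] /=; rewrite big_ord_recl tnth0 /=.
  rewrite mulrCA; do 2!congr (_ * _); apply: eq_bigr => b _.
  by rewrite tnthS.
exists (fun L => (thead L, [tuple of behead L])) => [[i L] _|L _] /=.
  by congr (_, _); apply: val_inj.
by rewrite [RHS]tuple_eta; apply: val_inj.
Qed.

(** * Alternating forms: column operations and exchange relations *)

Section Alternating.
Variable F : seq int -> R.
Hypothesis altF : forall (A B : seq int) x y, F (A ++ x :: y :: B) = - F (A ++ y :: x :: B).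
Hypothesis two_reg : forall x : R, x + x = 0 -> x = 0.

Lemma mlin_swap A B v w : mlin F (A ++ v :: w :: B) = - mlin F (A ++ w :: v :: B).
Proof.
rewrite !mlin_cat -mulN1r -mlinZ; apply: eq_mlin => L _ _ /=.
under eq_bigr do rewrite mulr_sumr.
rewrite exchange_big mulr_sumr; apply: eq_bigr => l' _.
rewrite !mulr_sumr; apply: eq_bigr => l _ /=.
rewrite (_ : mlin _ B = - mlin (fun M => F (L ++ l' :: l :: M)) B); first by ring.
by rewrite -mulN1r -mlinZ; apply: eq_mlin => M _ _; rewrite altF mulN1r.
Qed.

Lemma mlin_dup A B v : mlin F (A ++ v :: v :: B) = 0.
Proof. by apply: two_reg; rewrite {1}mlin_swap addNr. Qed.

Lemma mlin_move A B D v :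
  mlin F (A ++ B ++ v :: D) = (-1) ^+ size B * mlin F (A ++ v :: B ++ D).
Proof.
elim: B A => [|w B IH] A; first by rewrite mul1r.
rewrite mlin_swap exprS /= -(cat_rcons w A (B ++ _)) IH cat_rcons; ring.
Qed.

Lemma mlin_repeat A B D v : mlin F (A ++ v :: B ++ v :: D) = 0.
Proof. by rewrite -cat_rcons mlin_move cat_rcons mlin_dup mulr0. Qed.

Lemma mlin_shear A B v w u c : (forall l, u l = v l + c * w l) ->
  mlin F (A ++ w :: u :: B) = mlin F (A ++ w :: v :: B).
Proof.
move=> E; rewrite -!(cat_rcons w A) (mlin_lin F _ _ E) !cat_rcons mlin_dup.
by rewrite mulr0 addr0.
Qed.

(** Columns are reduced from right to left, so that each is sheared by a left neighbour which is not
    yet reduced. *)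
Lemma mlin_chain (v v0 : nat -> int -> R) c A s n :
  (forall b l, (s <= b)%N -> v b.+1 l = v0 b.+1 l + c * v b l) ->
  mlin F (A ++ v s :: map v (iota s.+1 n)) = mlin F (A ++ v s :: map v0 (iota s.+1 n)).
Proof.
move=> E; elim: n A s E => [//|n IH] A s E /=.
rewrite -cat_rcons IH ?cat_rcons; last by move=> b l le; apply: E; lia.
by apply: mlin_shear => l; apply: E.
Qed.

(* The vectors v1, v2, v3 are h-columns at three, two and one added points;
   clearing denominators exhibits the three-point value as a wedge of one-point columns. *)
Lemma mlin_three_points v1 v2 v2' va vb vc (p q s : R) B :
  (forall l, (p - s) * v1 l = v2 l - v2' l) ->
  (forall l, (p - q) * v2 l = va l - vb l) ->
  (forall l, (q - s) * v2' l = vb l - vc l) ->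
  (p - q) * (p - s) * (q - s) * mlin F (v1 :: v2 :: va :: B)
  = mlin F (va :: vb :: vc :: B).
Proof.
move=> E1 E2 E3.
have sw0 D v w : mlin F (v :: w :: D) = - mlin F (w :: v :: D) := mlin_swap [::] D v w.
have sw1 D u v w : mlin F (u :: v :: w :: D) = - mlin F (u :: w :: v :: D).
  exact: (mlin_swap [:: u]).
have dup0 D v : mlin F (v :: v :: D) = 0 := mlin_dup [::] D v.
have step D u v w c : (forall l, c * u l = v l - w l) ->
    c * mlin F (u :: D) = mlin F (v :: D) - mlin F (w :: D).
  move=> E; rewrite -(@mlin_scale F [::] _ u (fun l => c * u l)) //.
  by rewrite (@mlin_lin F [::] _ v w _ (-1)) /= => [|l]; rewrite ?E mulN1r.
transitivity ((q - s) * ((p - q) * ((p - s) * mlin F [:: v1, v2, va & B]))).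
  by ring.
rewrite (step _ _ _ _ _ E1) dup0 sub0r sw0 opprK (step _ _ _ _ _ E2).
rewrite (sw1 _ va v2') dup0 oppr0 sub0r sw0 opprK (step _ _ _ _ _ E3).
by rewrite dup0 sub0r (sw1 _ vc vb) opprK (sw0 _ vc) (sw1 _ va) opprK.
Qed.

Local Arguments mlin : simpl never.

(** The relation for I = (a, b, B) and J = (c, d, e, g, B): exchanging a member of B repeats a
    column, so four terms survive. *)
Lemma mlin_plucker3 n (Pl : forall I J, size I = n.+2 -> size J = n.+4 ->
    all (fun l => l \in r) I -> all (fun l => l \in r) J ->
    \sum_(j < n.+4) (-1) ^+ j * F (rcons I (nth 0 J j)) * F (take j J ++ drop j.+1 J) = 0)
  B a b c d e g : size B = n ->
  let Phi x y z := mlin F (x :: y :: z :: B) in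
  Phi a b c * Phi d e g - Phi a b d * Phi c e g
  + Phi a b e * Phi c d g - Phi a b g * Phi c d e = 0.
Proof.
move=> sB Phi.
have := @mlin_plucker n.+2 F [:: a, b & B] [:: c, d, e, g & B] a Pl.
rewrite /= sB => /(_ erefl erefl).
have M x : mlin F [:: a, b & rcons B x] = (-1) ^+ n * Phi a b x.
  by rewrite -cats1 (mlin_move [:: a; b]) cats0 sB.
rewrite !big_ord_recl /= big1 => [|j _]; last first.
  rewrite (_ : mlin F [:: a, b & _] = 0) ?mulr0 ?mul0r //.
  rewrite /bump /= ?add1n /= M /Phi.
  have jB : (j < size B)%N by rewrite sB.
  rewrite -[B in mlin _ [:: _, _, _ & B]](cat_take_drop j) (drop_nth a jB).
  by rewrite (mlin_repeat [:: a; b]) mulr0.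
rewrite !M /= /bump /= !addn0 ?add1n expr0 !exprS expr0.
rewrite ?drop0 ?take0 /= => E.
(* Moving the exchanged vector in front of B contributes the same sign (-1)^n to each of the four
   terms. *)
have : (-1) ^+ n * ((-1) ^+ n * (Phi a b c * Phi d e g - Phi a b d * Phi c e g
  + Phi a b e * Phi c d g - Phi a b g * Phi c d e)) = 0.
  by rewrite -[RHS](mulr0 ((-1) ^+ n)) -E /Phi; ring.
by rewrite signrMK.
Qed.
End Alternating.

End Multilinear.

(** * Sequences in a box and partitions *)

(** The sorting sign is the sign of a Vandermonde determinant. Its behaviour under permutations then
    follows from multiplicativity of determinants instead of a count of inversions. *)
Definition vdm n (t : n.-tuple int) : int :=
  \det (Vandermonde n (\row_i tnth t i)).

Lemma vdm_perm n (t : n.-tuple int) (s : 'S_n) :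
  vdm [tuple tnth t (s i) | i < n] = (-1) ^+ s * vdm t.
Proof.
have -> : vdm [tuple tnth t (s i) | i < n] =
    \det (col_perm s (Vandermonde n (\row_i tnth t i))).
  by congr (\det _); apply/matrixP => i j; rewrite !mxE tnth_mktuple.
by rewrite col_permE det_mulmx det_perm odd_permV mulrC.
Qed.

Lemma sgnL_vdm n (t : n.-tuple int) : sgnL t = (sgz (vdm t))%:~R.
Proof.
rewrite /vdm det_Vandermonde /sgnL; case: ifP => [u|/negbT nu]; last first.
  have [i [j [lij E]]] : exists i j : 'I_n, (i < j)%N /\ tnth t i = tnth t j.
    move/(uniqPn (0 : int)): nu => [a [b [ab bs E]]].
    rewrite size_tuple in bs; exists (Ordinal (ltn_trans ab bs)), (Ordinal bs).
    by rewrite !(tnth_nth 0).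
  by rewrite (bigD1 i) //= (bigD1 j) //= !mxE E subrr !mul0r sgz0.
rewrite size_tuple (big_morph _ (@sgzM int) (@sgz1 int)) rmorph_prod -prodrXr.
apply: eq_bigr => i _; rewrite (big_morph _ (@sgzM int) (@sgz1 int)) rmorph_prod -prodrXr.
apply: eq_bigr => j lij; rewrite !mxE !(tnth_nth 0).
have ne : nth 0 t i != nth 0 t j.
  by rewrite nth_uniq ?size_tuple //; apply: contraTneq lij => ->; rewrite ltnn.
case: (ltgtP (nth 0 t j) (nth 0 t i)) => [lt|gt|E]; last by rewrite E eqxx in ne.
  by rewrite ltr0_sgz ?subr_lt0 ?expr1 ?rmorphN1.
by rewrite gtr0_sgz ?subr_gt0 ?expr0.
Qed.

Lemma sgnL_perm n (t : n.-tuple int) (s : 'S_n) :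
  sgnL [tuple tnth t (s i) | i < n] = (-1) ^+ s * sgnL t.
Proof. by rewrite !sgnL_vdm vdm_perm; case: odd_perm; rewrite ?mulN1r ?sgzN ?rmorphN ?mul1r. Qed.

Lemma lamL_perm_eq L L' : perm_eq L L' -> lamL L = lamL L'.
Proof.
move=> p; rewrite /lamL (perm_size p).
have -> // : sort (fun a b : int => a <= b) L = sort (fun a b : int => a <= b) L'.
by apply/perm_sortP; [apply: le_total | apply: le_trans | apply: le_anti |].
Qed.

Lemma pitilde_perm pi n (t : n.-tuple int) (s : 'S_n) :
  pitilde pi [tuple tnth t (s i) | i < n] = (-1) ^+ s * pitilde pi t.
Proof.
rewrite /pitilde sgnL_perm -mulrA; congr (_ * (_ * pi _)).
by apply: lamL_perm_eq; apply/tuple_permP; exists s.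
Qed.

Lemma pitilde_nuniq pi L : ~~ uniq L -> pitilde pi L = 0.
Proof. by rewrite /pitilde /sgnL => /negbTE ->; rewrite mul0r. Qed.

Lemma pitilde_swap pi (A B : seq int) x y :
  pitilde pi (A ++ x :: y :: B) = - pitilde pi (A ++ y :: x :: B).
Proof.
pose t := in_tuple (A ++ y :: x :: B); set n := size (A ++ y :: x :: B) in t.
have nE : n = (size A + (size B).+2)%N by rewrite /n size_cat.
have i1 : (size A < n)%N by lia.
have i2 : ((size A).+1 < n)%N by lia.
pose s := tperm (Ordinal i1) (Ordinal i2).
have -> : A ++ x :: y :: B = [tuple tnth t (s i) | i < n].
  apply: (@eq_from_nth _ 0) => [|k]; first by rewrite size_tuple nE size_cat.
  rewrite size_cat /= -nE => kn.
  have -> : nth 0 [tuple tnth t (s i) | i < n] k = tnth t (s (Ordinal kn)).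
    by rewrite -(tnth_nth _ _ (Ordinal kn)) tnth_mktuple.
  rewrite (tnth_nth 0) /= /s; case: tpermP => [/(congr1 val) /= ->|/(congr1 val) /= ->|].
  - by rewrite !nth_cat ltnn subnn ltnNge leqnSn /= subSnn.
  - by rewrite !nth_cat ltnn subnn ltnNge leqnSn /= subSnn.
  move=> k1 k2; rewrite !nth_cat /=; case: ltnP => // le.
  have k1' : k <> size A by move=> E; apply: k1; apply: val_inj.
  have k2' : k <> (size A).+1 by move=> E; apply: k2; apply: val_inj.
  by have -> : (k - size A = (k - size A - 2).+2)%N by lia.
by rewrite pitilde_perm odd_tperm -val_eqE /= eqn_leq ltnn andbF expr1 mulN1r.
Qed.

Section BoxSum.
Variable N : nat.

(** The window {-N, ..., N-1}, exactly the range of the numbers s_a - a - 1 for partitions s inside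
    the N x N box. *)
Definition box (i : 'I_(N + N)) : int := i%:Z - N%:Z.
Definition boxseq : seq int := [seq box i | i <- enum 'I_(N + N)].

Lemma ellP (s : N.-tuple 'I_N.+1) (a : 'I_N) : (tnth s a + (N - a.+1) < N + N)%N.
Proof. by have := ltn_ord (tnth s a); have := ltn_ord a; lia. Qed.

(* In terms of a partition s of at most N parts, the strictly decreasing
   sequence s_a - a - 1, shifted by N. *)
Definition ell (s : N.-tuple 'I_N.+1) : N.-tuple 'I_(N + N) :=
  [tuple Ordinal (ellP s a) | a < N].

Definition is_part (s : N.-tuple 'I_N.+1) := sorted geq [seq nat_of_ord x | x <- s].

Lemma is_partP (s : N.-tuple 'I_N.+1) :
  reflect (forall a b : 'I_N, (a <= b)%N -> (tnth s b <= tnth s a)%N) (is_part s).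
Proof.
have E (a : 'I_N) : nat_of_ord (tnth s a) = nth 0%N [seq nat_of_ord x | x <- s] a.
  by rewrite (tnth_nth ord0) (nth_map ord0) ?size_tuple.
apply: (iffP idP) => [so a b ab|mono].
  have := @sorted_leq_nth _ geq _ _ 0%N _ so a b.
  rewrite !inE !size_map size_tuple !ltn_ord -!E; apply=> //.
    by move=> x y z; rewrite /geq /=; lia.
  by move=> x; rewrite /geq /=.
apply/(sortedP 0%N) => i; rewrite size_map size_tuple => lt.
by rewrite /geq /= -(E (Ordinal lt)) -(E (Ordinal (ltnW lt))) mono.
Qed.

Lemma ell_ltn (s : N.-tuple 'I_N.+1) (a b : 'I_N) :
  is_part s -> (a < b)%N -> (tnth (ell s) b < tnth (ell s) a)%N.
Proof.
move=> /is_partP H ab; have := H a b (ltnW ab).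
by rewrite !tnth_mktuple /=; have := ltn_ord b; lia.
Qed.

Lemma ell_inj (s : N.-tuple 'I_N.+1) (a b : 'I_N) :
  is_part s -> tnth (ell s) a = tnth (ell s) b -> a = b.
Proof.
move=> ps E; apply: val_inj => /=; case: (ltngtP a b) => // lt.
  by have := ell_ltn ps lt; rewrite E ltnn.
by have := ell_ltn ps lt; rewrite E ltnn.
Qed.

Definition ellperm (p : N.-tuple 'I_N.+1 * 'S_N) : N.-tuple 'I_(N + N) :=
  [tuple tnth (ell p.1) (p.2 b) | b < N].

Lemma tnth_ellperm p b : tnth (ellperm p) b = tnth (ell p.1) (p.2 b).
Proof. exact: tnth_mktuple. Qed.

Definition ordseq (L : N.-tuple 'I_(N + N)) : seq nat := [seq nat_of_ord x | x <- L].

Lemma nth_ordseq L (a : 'I_N) : nth 0%N (ordseq L) a = tnth L a.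
Proof.
by rewrite -(tnth_nth _ [tuple of ordseq L]) tnth_map.
Qed.

Lemma sorted_ell (s : N.-tuple 'I_N.+1) : is_part s -> sorted gtn (ordseq (ell s)).
Proof.
move=> ps; apply/(sortedP 0%N) => i; rewrite size_map size_tuple => lt.
by rewrite (nth_ordseq _ (Ordinal lt)) (nth_ordseq _ (Ordinal (ltnW lt))) /= ell_ltn.
Qed.

Lemma ellperm_inj : {in [pred p | is_part p.1] &, injective ellperm}.
Proof.
move=> [s u] [s' u']; rewrite !inE /= => ps ps' E.
have mem q : ordseq (ellperm q) =i ordseq (ell q.1).
  move=> x; apply/mapP/mapP => -[y /tnthP [i ->] ->].
    by rewrite tnth_ellperm; exists (tnth (ell q.1) (q.2 i)); rewrite ?mem_tnth.
  exists (tnth (ell q.1) i) => //.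
  by apply/tnthP; exists (q.2^-1 i)%g; rewrite tnth_ellperm permKV.
have El : ell s = ell s'.
  apply: val_inj; apply: (inj_map val_inj).
  apply: (irr_sorted_eq (leT := gtn)).
  - by move=> x y z /= ; lia.
  - by move=> x /=; lia.
  - exact: sorted_ell.
  - exact: sorted_ell.
  by move=> x; rewrite -(mem (s, u)) E mem.
have Es : s = s'.
  apply: eq_from_tnth => a; apply: val_inj.
  move/(congr1 (fun t => nat_of_ord (tnth t a))): El.
  by rewrite !tnth_mktuple /= => /addIn.
congr (_, _) => //; apply/permP => b; apply: (ell_inj ps).
by move/(congr1 (fun t => tnth t b)): E; rewrite !tnth_ellperm El.
Qed.

Lemma strict_decr (g : nat -> nat) : (forall a, (a.+1 < N)%N -> (g a.+1 < g a)%N) ->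
  forall a d, (a + d < N)%N -> (g (a + d) + d <= g a)%N.
Proof.
move=> H a; elim=> [|d IH]; rewrite ?addn0 // addnS => lt.
by have := IH (ltnW lt); have := H _ lt; lia.
Qed.

(** Sorting decreasingly and subtracting the staircase N-1, ..., 0 recovers the partition. *)
Lemma ellperm_surj (L : N.-tuple 'I_(N + N)) : uniq L ->
  exists2 p, is_part p.1 & L = ellperm p.
Proof.
move=> uL; have uO : uniq (ordseq L) by rewrite map_inj_uniq //; apply: val_inj.
pose D := sort geq (ordseq L).
have sD : size D == N by rewrite size_sort size_map size_tuple.
have soD : sorted gtn D.
  rewrite (sorted_pairwise (leT := gtn)); last by move=> x y z /=; lia.
  have := sort_sorted (leT := geq) (fun x y => leq_total y x) (ordseq L).
  rewrite -/D sorted_pairwise; last by move=> x y z; rewrite /geq /=; lia.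
  have : uniq D by rewrite sort_uniq.
  rewrite uniq_pairwise => u g; have := conj u g => /andP.
  rewrite -pairwise_relI; apply: sub_pairwise => x y /=.
  by rewrite /geq /=; lia.
have decr a : (a.+1 < N)%N -> (nth 0%N D a.+1 < nth 0%N D a)%N.
  by move/(sortedP 0%N): soD; rewrite (eqP sD); apply.
(* The lower bound makes the truncated subtraction of the staircase exact; the upper bound keeps the
   parts at most N. *)
have bnd a : (a < N)%N -> (N - a.+1 <= nth 0%N D a)%N /\ (nth 0%N D a + a < N + N)%N.
  move=> aN; split.
    have lt : (a + (N - a.+1) < N)%N by lia.
    by have := strict_decr decr lt; lia.
  have lt0 : (0 + a < N)%N by [].
  have := strict_decr decr lt0; rewrite add0n => le.
  have : nth 0%N D 0 \in ordseq L by rewrite -(mem_sort geq) mem_nth // (eqP sD); lia.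
  by case/mapP => x _ E; have := ltn_ord x; lia.
have sP (a : 'I_N) : (nth 0%N D a - (N - a.+1) < N.+1)%N.
  by have := bnd a (ltn_ord a); have := ltn_ord a; lia.
pose s := [tuple Ordinal (sP a) | a < N].
have Ls a : nat_of_ord (tnth (ell s) a) = nth 0%N D a.
  by rewrite tnth_mktuple /= /s tnth_mktuple /=; have := bnd a (ltn_ord a); lia.
have /tuple_permP [u Eu] : perm_eq (ordseq L) (Tuple sD) by rewrite perm_sym /= perm_sort.
exists (s, u).
  apply/is_partP => a b; rewrite leq_eqVlt => /orP[/eqP/val_inj -> //|ab].
  have lt : (a + (b - a) < N)%N by have := ltn_ord b; lia.
  have := strict_decr decr lt; rewrite subnKC ?(ltnW ab) // !tnth_mktuple /=.
  by have := bnd b (ltn_ord b); have := bnd a (ltn_ord a); have := ltn_ord b; lia.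
apply: eq_from_tnth => b; apply: val_inj => /=.
rewrite -nth_ordseq Eu -(tnth_nth 0%N) tnth_mktuple tnth_ellperm Ls.
by rewrite (tnth_nth 0%N).
Qed.
End BoxSum.

(** * The truncated tau-function as a multilinear form *)

Definition jtmx (T : nat -> ser) (lam : seq nat) n : 'M[ser]_n :=
  \matrix_(a, b) hZ T ((nth 0%N lam a)%:Z - a%:Z + b%:Z).

Lemma schurT_det T lam : schurT T lam = \det (jtmx T lam (size lam)).
Proof.
apply: serP => m; rewrite /determinant ser_sum /schurT; apply: eq_bigr => s _.
rewrite sprodE big_map big_enum /=.
have -> : \prod_(a < size lam) jtmx T lam (size lam) a (s a) =
  \prod_(a < size lam) hZ T ((nth 0%N lam a)%:Z - a%:Z + (s a)%:Z).
  by apply: eq_bigr => a _; rewrite mxE.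
by case: odd_perm; rewrite ?mul1r // !mulN1r.
Qed.

(** A zero part adds a bottom row (0, ..., 0, 1), since h_0 = 1 and h_z = 0 for z < 0. *)
Lemma jtmx_pad T lam n : (size lam <= n)%N -> \det (jtmx T lam n.+1) = \det (jtmx T lam n).
Proof.
move=> le; rewrite (expand_det_row _ ord_max) big_ord_recr big1 ?add0r /= => [|j _].
  rewrite mxE nth_default //= subrK /= hT0 mul1r /cofactor.
  rewrite addnn -muln2 mulnC exprM sqrrN expr1n expr1n mul1r.
  by rewrite add0r; congr (\det _); apply/matrixP => a b; rewrite !mxE !lift_max.
rewrite mxE nth_default //=.
have lt := ltn_ord j.
have -> : 0%:Z - n%:Z + j%:Z = Negz (n - j.+1) by lia.
exact: mul0r.
Qed.

Lemma jtmx_widen T lam n : (size lam <= n)%N ->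
  \det (jtmx T lam (size lam)) = \det (jtmx T lam n).
Proof.
move=> le; rewrite -(subnKC le); elim: (n - size lam)%N => [|d IH]; first by rewrite addn0.
by rewrite addnS jtmx_pad ?leq_addr.
Qed.

Lemma nth_filter_pos (s : seq nat) i : sorted geq s ->
  nth 0%N [seq x <- s | (0 < x)%N] i = nth 0%N s i.
Proof.
elim: s i => [//|x s IH] i /=; rewrite (path_sortedE (leT := geq)); last first.
  by move=> a b c; rewrite /geq /=; lia.
case/andP => xs so; case: x xs => [|x] xs /=; last by case: i => //= i; apply: IH.
have /eq_in_filter -> : {in s, (fun x => 0 < x)%N =1 xpred0}.
  by move=> y /(allP xs); rewrite /geq /=; case: y.
rewrite filter_pred0 nth_nil; case: i => //= i.
case: (ltnP i (size s)) => [lt|ge]; last by rewrite nth_default.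
by have /(allP xs) := mem_nth 0%N lt; rewrite /geq /= leqn0 => /eqP.
Qed.

Lemma schurT_filter T n (s : seq nat) : sorted geq s -> size s = n ->
  schurT T [seq x <- s | (0 < x)%N] = \det (jtmx T s n).
Proof.
move=> so <-; rewrite schurT_det (@jtmx_widen _ _ (size s)) ?size_filter ?count_size //.
by congr (\det _); apply/matrixP => a b; rewrite !mxE nth_filter_pos.
Qed.

Definition parts N (s : N.-tuple 'I_N.+1) : seq nat :=
  [seq x <- [seq nat_of_ord x | x <- s] | (0 < x)%N].

Lemma tau_partialE pi T N : tau_partial pi T N =
  \sum_(s : N.-tuple 'I_N.+1 | is_part s) sC (pi (parts s)) * schurT T (parts s).
Proof. by apply: serP => m; rewrite ser_sum; apply: eq_bigr => s _; rewrite serZ. Qed.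

(** The sign of reversing N entries: [ell] lists its entries decreasingly, so every pair is an
    inversion. *)
Definition revsign N : C :=
  (-1) ^+ (\sum_(a < N) \sum_(b < N | (a < b)%N) 1)%N.

Lemma pitilde_ell pi N (s : N.-tuple 'I_N.+1) : is_part s ->
  pitilde pi [seq box x | x <- ell s] = revsign N * pi (parts s).
Proof.
move=> ps; set L := [seq box x | x <- ell s].
have nthL (a : 'I_N) : nth 0 L a = (tnth s a)%:Z - a%:Z - 1.
  rewrite -(tnth_nth _ [tuple of L]) tnth_map tnth_mktuple /box /=.
  by have := ltn_ord a; lia.
have ltL (a b : 'I_N) : (a < b)%N -> nth 0 L b < nth 0 L a.
  by move=> ab; rewrite !nthL; have /is_partP/(_ a b (ltnW ab)) := ps; lia.
have sL : size L = N by rewrite size_map size_tuple.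
have uL : uniq L.
  rewrite map_inj_uniq; last by move=> x y /addIr [] /val_inj.
  by apply/tuple_uniqP => a b; apply: ell_inj.
rewrite /pitilde /sgnL uL sL; congr (_ ^+ _ * pi _).
  apply: eq_bigr => a _; apply: eq_bigr => b ab.
  by rewrite ltL.
have sortL : sort (fun a b : int => a <= b) L = rev L.
  apply: (sorted_eq (leT := <=%O)); [exact: le_trans | exact: le_anti | | |].
  - by apply: sort_sorted; apply: le_total.
  - rewrite rev_sorted; apply/(sortedP 0) => i; rewrite sL => lt /=.
    by apply/ltW/(ltL (Ordinal (ltnW lt)) (Ordinal lt)).
  by rewrite perm_sort perm_sym perm_rev.
rewrite /lamL sortL /parts sL; congr filter.
apply: (@eq_from_nth _ 0%N) => [|i]; rewrite !size_map size_iota ?size_tuple // => lt.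
rewrite (nth_map 0%N) ?size_iota // nth_iota // add0n nth_rev ?sL; last by lia.
have -> : (N - (N - i.+1).+1 = i)%N by lia.
rewrite (nthL (Ordinal lt)) (nth_map ord0) ?size_tuple // -(tnth_nth ord0 s (Ordinal lt)) /=.
by lia.
Qed.

(** At l = s_a - a - 1 the Jacobi-Trudi entry h_(s_a - a + b) lies in column b+1, so the columns are
    numbered from 1. *)
Definition hcol (T : nat -> ser) (b : nat) (l : int) : ser := hZ T (l + b%:Z).
Definition pluckF pi (L : seq int) : ser := sC (pitilde pi L).

(* The Jacobi--Trudi expansion over the N x N box is the multilinear form
   of the Plücker coordinates at the columns of complete functions. *)
Lemma tau_partial_mlin pi T N :
  mlin (boxseq N) (pluckF pi) [seq hcol T b | b <- iota 1 N]
  = sC (revsign N) * tau_partial pi T N.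
Proof.
have tmap (t : N.-tuple 'I_(N + N)) (s : 'S_N) :
   [seq box x | x <- [tuple tnth t (s i) | i < N]] =
   [tuple tnth [tuple of [seq box x | x <- t]] (s i) | i < N] :> seq int.
  rewrite /= -map_comp; apply: eq_map => i /=.
  by rewrite tnth_map.
rewrite (@mlin_tuple _ _ (N + N) (@box N) _ N _ (fun=> 0)) ?size_map ?size_iota //.
rewrite (bigID (fun L : N.-tuple 'I_(N + N) => uniq L)) /= [X in _ + X]big1 ?addr0; last first.
  move=> L nu; rewrite /pluckF pitilde_nuniq ?rmorph0 ?mul0r //.
  by rewrite map_inj_uniq // => x y /addIr [] /val_inj.
(* A tuple of distinct indices is a partition together with a permutation; for a fixed partition the
   sum over permutations is the Leibniz formula of its Jacobi-Trudi determinant. *)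
rewrite (eq_bigl (fun L => L \in [set ellperm p | p in [pred p | is_part p.1]])); last first.
  move=> L; apply/idP/imsetP => [/ellperm_surj [p ps ->]|[p ps ->]]; first by exists p.
  apply/tuple_uniqP => a b; rewrite !tnth_ellperm => /(ell_inj ps).
  exact: perm_inj.
rewrite big_imset /=; last exact: ellperm_inj.
rewrite tau_partialE mulr_sumr.
transitivity (\sum_(s : N.-tuple 'I_N.+1 | is_part s) \sum_(u : 'S_N)
   pluckF pi [seq box x | x <- ellperm (s, u)] *
     \prod_(b < N) nth (fun=> 0) [seq hcol T b | b <- iota 1 N] b
        (box (tnth (ellperm (s, u)) b))).
  rewrite pair_big_dep; apply: eq_big => [[s u]|[s u] _ //].
  by rewrite inE /= andbT.
apply: eq_bigr => s ps.
rewrite (schurT_filter T (n := N)) ?size_map ?size_tuple // -det_tr mulrA.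
rewrite -rmorphM -pitilde_ell // mulr_sumr; apply: eq_bigr => u _.
rewrite /pluckF tmap pitilde_perm rmorphM /= rmorph_sign -mulrA mulrCA.
congr (_ * (_ * _)); apply: eq_bigr => b _.
rewrite (nth_map 0%N) ?size_iota // nth_iota // tnth_ellperm !mxE /hcol.
rewrite tnth_mktuple /box /= (nth_map ord0) ?size_tuple // -(tnth_nth ord0).
congr (hZ T _); have := ltn_ord (u b); lia.
Qed.

(** * Miwa shifts *)

Definition miwa (T : nat -> ser) (x : ser) : nat -> ser :=
  fun j => T j + sC (j%:R^-1) * x ^+ j.

Lemma miwaC T x y : miwa (miwa T x) y = miwa (miwa T y) x.
Proof. by apply: funext => j; rewrite /miwa addrAC. Qed.

Lemma hZ_miwa T x z : hZ T z = hZ (miwa T x) z - x * hZ (miwa T x) (z - 1).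
Proof.
rewrite (@hZ_shift T) // => j; rewrite /miwa mulrDr mulrA; congr (_ + _).
have <- : sC (j.+1%:R) = j.+1%:R by apply: rmorph_nat.
have -> : sC j.+1%:R * sC (j.+1%:R^-1) = 1.
  by rewrite -rmorphM /= mulfV ?rmorph1 // pnatr_eq0.
by rewrite mul1r.
Qed.

Lemma hcol_miwa T x b l : hcol (miwa T x) b.+1 l = hcol T b.+1 l + x * hcol (miwa T x) b l.
Proof.
rewrite /hcol (hZ_miwa T x (l + b.+1%:Z)).
have -> : l + b.+1%:Z - 1 = l + b%:Z by rewrite intS; ring.
by rewrite subrK.
Qed.

(** A divided difference in the added point: removing [y] or [x] from the same doubly shifted column
    gives two expansions to compare. *)
Lemma hcol_miwa2 T x y b l : (x - y) * hcol (miwa (miwa T x) y) b l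
  = hcol (miwa T x) b.+1 l - hcol (miwa T y) b.+1 l.
Proof.
have E1 := hcol_miwa (miwa T x) y b l.
have E2 := hcol_miwa (miwa T y) x b l.
rewrite miwaC in E2; rewrite E1 in E2.
rewrite mulrBl; apply/eqP; rewrite subr_eq addrAC eq_sym subr_eq; apply/eqP.
by rewrite E2 addrC.
Qed.

Definition vdm3 (x y z : ser) : ser := (x - y) * (x - z) * (y - z).

Lemma pluckF_alt pi (A B : seq int) x y :
  pluckF pi (A ++ x :: y :: B) = - pluckF pi (A ++ y :: x :: B).
Proof. by rewrite /pluckF pitilde_swap rmorphN. Qed.

Lemma ser_two_reg (f : ser) : f + f = 0 -> f = 0.
Proof. by move=> E; apply: (@ser_natmul_eq0 1); rewrite mulr_natl mulr2n. Qed.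

(** Three rounds of [mlin_chain] strip [z] from column 2 on, [y] from column 3 on and [x] from
    column 4 on. The first three columns then have the shape required by [mlin_three_points]. *)
Lemma tau_partial_three pi T n x y z :
  vdm3 x y z * (sC (revsign n.+3) * tau_partial pi (miwa (miwa (miwa T x) y) z) n.+3) =
  mlin (boxseq n.+3) (pluckF pi) [:: hcol (miwa T x) 3, hcol (miwa T y) 3, hcol (miwa T z) 3
     & [seq hcol T b | b <- iota 4 n]].
Proof.
have alt := @pluckF_alt pi.
rewrite -tau_partial_mlin.
have chain S w A s m := @mlin_chain _ (boxseq n.+3) _ alt ser_two_reg
   (hcol (miwa S w)) (hcol S) w A s m (fun b l _ => hcol_miwa S w b l).
rewrite [iota 1 n.+3]/= [map _ _]/=.
rewrite (chain (miwa (miwa T x) y) z [::] 1%N n.+2) [iota _ _]/= [map _ _]/=.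
rewrite (chain (miwa T x) y [:: _] 2%N n.+1) [iota _ _]/= [map _ _]/=.
rewrite (chain T x [:: _; _] 3%N n).
apply: (@mlin_three_points _ _ _ alt ser_two_reg _ _ (hcol (miwa (miwa T y) z) 2)) => l.
- by rewrite (miwaC T x y) hcol_miwa2.
- by rewrite hcol_miwa2.
- by rewrite hcol_miwa2.
Qed.

Lemma pluckF_plucker pi n I J : plucker pi ->
  size I = n.+2 -> size J = n.+4 ->
  all (fun l => l \in boxseq n.+3) I -> all (fun l => l \in boxseq n.+3) J ->
  \sum_(j < n.+4) (-1) ^+ j * pluckF pi (rcons I (nth 0 J j))
     * pluckF pi (take j J ++ drop j.+1 J) = 0.
Proof.
move=> Pl sI sJ aI aJ.
have rng l : l \in boxseq n.+3 -> in_range n.+3 (n.+3 + n.+3) l.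
  by case/mapP => i _ ->; rewrite /in_range /box; have := ltn_ord i; lia.
(* For k = n+3 and N = 2k the range {-k, ..., N-k-1} is the window of [boxseq]. *)
have kN : (0 < n.+3 < n.+3 + n.+3)%N by lia.
have := Pl _ _ kN I J sI sJ (sub_all rng aI) (sub_all rng aJ).
move=> /(congr1 sC); rewrite rmorph0 rmorph_sum => E.
apply/eqP; rewrite -oppr_eq0 -sumrN; apply/eqP; rewrite -[RHS]E.
apply: eq_bigr => j _.
by rewrite /pluckF !rmorphM /= rmorph_sign exprS; ring.
Qed.

Lemma revsign_sq n : sC (revsign n) * sC (revsign n) = 1.
Proof. by rewrite -rmorphM /= /revsign -expr2 sqrr_sign rmorph1. Qed.

Lemma tau_partial_plucker pi T n a b c d e g : plucker pi ->
  let f x y z := vdm3 x y z * tau_partial pi (miwa (miwa (miwa T x) y) z) n.+3 in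
  f a b c * f d e g - f a b d * f c e g + f a b e * f c d g - f a b g * f c d e = 0.
Proof.
move=> Pl f.
have := @mlin_plucker3 _ (boxseq n.+3) _ (@pluckF_alt pi) ser_two_reg n
  (fun I J sI sJ aI aJ => pluckF_plucker Pl sI sJ aI aJ) [seq hcol T b | b <- iota 4 n]
  (hcol (miwa T a) 3) (hcol (miwa T b) 3) (hcol (miwa T c) 3)
  (hcol (miwa T d) 3) (hcol (miwa T e) 3) (hcol (miwa T g) 3).
rewrite size_map size_iota => /(_ erefl); cbv beta zeta.
rewrite -!tau_partial_three => E; rewrite -[RHS]E.
rewrite -[LHS]mul1r -(revsign_sq n.+3) /f.
move: (sC _) (vdm3 a b c) (vdm3 d e g) (vdm3 a b d) (vdm3 c e g) (vdm3 a b e)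
  (vdm3 c d g) (vdm3 a b g) (vdm3 c d e) (tau_partial _ _ _) (tau_partial _ _ _)
  (tau_partial _ _ _) (tau_partial _ _ _) (tau_partial _ _ _) (tau_partial _ _ _)
  (tau_partial _ _ _) (tau_partial _ _ _) => *; ring.
Qed.

(** * Stabilisation of the truncated tau-function *)

Lemma homog_schurT T lam : graded T -> homog (sumn lam)%:Z (schurT T lam).
Proof.
move=> gT; rewrite schurT_det /determinant; apply: homog_sum => s _.
rewrite -[X in homog X _]add0r; apply: homogM.
  by case: odd_perm; rewrite ?expr1 ?expr0 -?(rmorph1 sC) -?rmorphN; apply: homogC.
(* The shifts -a and s(a) cancel in total, so every Leibniz term has degree |lam|. *)
have -> : (sumn lam)%:Z =
    \sum_(a < size lam) ((nth 0%N lam a)%:Z - a%:Z + (s a)%:Z).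
  rewrite big_split /= sumrB.
  have -> : \sum_(a < size lam) (s a)%:Z = \sum_(a < size lam) a%:Z.
    by rewrite [RHS](reindex_inj (@perm_inj _ s)).
  rewrite subrK sumnE (big_nth 0%N) big_mkord.
  by rewrite (big_morph Posz PoszD (erefl : Posz 0 = 0)).
by apply: homog_prod => a _; rewrite mxE; apply: homog_hZ.
Qed.

Lemma nth_parts N (s : N.-tuple 'I_N.+1) (a : 'I_N) : is_part s ->
  nth 0%N (parts s) a = tnth s a.
Proof.
by move=> ps; rewrite nth_filter_pos // (nth_map ord0) ?size_tuple // -tnth_nth.
Qed.

Lemma parts_inj N : {in [pred s : N.-tuple 'I_N.+1 | is_part s] &, injective (@parts N)}.
Proof.
move=> s s'; rewrite !inE => ps ps' E; apply: eq_from_tnth => a; apply: val_inj => /=.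
by rewrite -!nth_parts // E.
Qed.

Definition partsseq N := [seq parts s | s : N.-tuple 'I_N.+1 in [pred s | is_part s]].

Lemma partsseq_uniq N : uniq (partsseq N).
Proof.
rewrite map_inj_in_uniq ?enum_uniq // => s s'; rewrite !mem_enum; exact: parts_inj.
Qed.

Lemma mem_partsseq N lam : (sumn lam <= N)%N ->
  (lam \in partsseq N) = is_partition lam.
Proof.
move=> le; apply/imageP/idP => [[s ps ->]|/andP[so pos]].
  rewrite /is_partition filter_all andbT; apply: sorted_filter => //.
  by move=> x y z; rewrite /geq /=; lia.
have sz : (size lam <= N)%N.
  apply: leq_trans le; elim: lam pos {so} => //= x l IH /andP[x0 /IH]; lia.
have bnd i : (nth 0 lam i < N.+1)%N.
  rewrite ltnS; apply: leq_trans le; case: (ltnP i (size lam)) => [lt|/(nth_default 0%N) -> //].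
  by rewrite sumnE (big_nth 0%N) big_mkord (bigD1 (Ordinal lt)) //= leq_addr.
pose s := [tuple Ordinal (bnd a) | a < N].
have sE : [seq nat_of_ord x | x <- s] = lam ++ nseq (N - size lam) 0%N.
  apply: (@eq_from_nth _ 0%N); first by rewrite size_map size_tuple size_cat size_nseq subnKC.
  rewrite size_map size_tuple => i lt.
  rewrite (nth_map ord0) ?size_tuple // -(tnth_nth ord0 s (Ordinal lt)) tnth_mktuple /=.
  rewrite nth_cat; case: ltnP => // ge.
  by rewrite nth_nseq nth_default // if_same.
exists s; last by rewrite /parts sE filter_cat (all_filterP pos) filter_nseq cats0.
rewrite inE /is_part sE.
apply/(sortedP 0%N) => i _; rewrite !nth_cat !nth_nseq !if_same /geq /=.
case: (ltnP i.+1 (size lam)) => // lt; rewrite (ltnW lt).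
by move/(sortedP 0%N): so; apply.
Qed.

(** By homogeneity only partitions of size [wt m] contribute at m, and a box of side at least [wt m]
    contains all of them. *)
Lemma tau_partial_stable pi T m N M : graded T -> (wt m <= N)%N -> (wt m <= M)%N ->
  tau_partial pi T N m = tau_partial pi T M m.
Proof.
move=> gT.
pose G lam := pi lam * schurT T lam m.
have E K : tau_partial pi T K m =
    \sum_(lam <- [seq lam <- partsseq K | sumn lam == wt m]) G lam.
  rewrite big_filter big_mkcond big_map big_enum /= /tau_partial.
  apply: eq_bigr => s _; rewrite -/(parts s) -/(G _); case: eqP => // ne.
  rewrite /G; have [-> |/(homog_schurT gT) [] /esym //] := eqVneq (schurT T (parts s) m) 0.
  by rewrite mulr0.
move=> wN wM; rewrite !E; apply: perm_big; apply: uniq_perm.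
- exact/filter_uniq/partsseq_uniq.
- exact/filter_uniq/partsseq_uniq.
move=> lam; rewrite !mem_filter; case: eqP => //= w.
by rewrite !mem_partsseq ?w.
Qed.

HB.lock Definition xs (i : int) : ser := sV (xv i).

Lemma xdiffE i j : xdiff i j = xs i - xs j. Proof. by rewrite xs.unlock. Qed.

Lemma TshiftE (S : {fset int}) (n : Avec) j : finsupp n `<=` S ->
  Tshift n j = sV (tv j) + \sum_(i <- enum_fset S) sC ((n i)%:~R / j%:R) * xs i ^+ j.
Proof.
move=> sub; rewrite xs.unlock /Tshift ssumE big_map; congr (_ + _).
under eq_bigr do rewrite sscaleE spowE.
apply: big_fset_incl => // i _; rewrite memNfinsupp => /eqP ->.
by rewrite mul0r rmorph0 mul0r.
Qed.

Lemma graded_Tshift n : graded (Tshift n).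
Proof.
move=> j j0; rewrite (TshiftE _ (fsubset_refl _)); apply: homogD.
  by case: j j0 => // j _; apply: (@homogV (tv j.+1)).
apply: homog_sum => i _; rewrite -[X in homog X _]add0r; apply: homogM; first exact: homogC.
by rewrite -[X in homog X _]mul1r; apply: homogX; rewrite xs.unlock; apply: (@homogV (xv i)).
Qed.

Lemma aaddE n m x : aadd n m x = n x + m x.
Proof.
rewrite fsfunE inE; case: ifP => // /negbT; rewrite negb_or !memNfinsupp.
by case/andP => /eqP-> /eqP->.
Qed.

Lemma aoppE n x : aopp n x = - n x.
Proof.
by rewrite fsfunE; case: ifP => // /negbT; rewrite memNfinsupp => /eqP->; rewrite oppr0.
Qed.

Lemma alphaE p x : alpha p x = (x == p)%:Z.
Proof. by rewrite fsfunE inE; case: (x == p). Qed.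

Lemma Tshift_alpha n a : Tshift (aadd n (alpha a)) = miwa (Tshift n) (xs a).
Proof.
apply: funext => j; rewrite /miwa.
pose S := finsupp n `|` finsupp (aadd n (alpha a)) `|` [fset a].
have nS : finsupp n `<=` S by apply/fsubsetP => y yS; rewrite !in_fsetU yS.
have naS : finsupp (aadd n (alpha a)) `<=` S.
  by apply/fsubsetP => y yS; rewrite !in_fsetU yS orbT.
rewrite (TshiftE _ nS) (TshiftE _ naS).
rewrite -addrA; congr (_ + _).
have aS : a \in S by rewrite !inE eqxx orbT.
rewrite [in RHS](bigD1_seq a) ?fset_uniq //= [in LHS](bigD1_seq a) ?fset_uniq //=.
rewrite aaddE alphaE eqxx rmorphD /= mulrDl rmorphD /= mulrDl.
rewrite -!addrA; congr (_ + _); rewrite addrC mul1r; congr (_ + _).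
by apply: eq_bigr => i /negbTE ne; rewrite aaddE alphaE ne addr0.
Qed.

(** The partial sums are constant from [wt m] on, so the value chosen by [epsilon] is that
    constant. *)
Lemma tau_shiftE pi n m N : (wt m <= N)%N ->
  tau_shift pi n m = tau_partial pi (Tshift n) N m.
Proof.
move=> wN; rewrite /tau_shift /ev_lim.
set P := fun c : C => _.
have PN : P (tau_partial pi (Tshift n) N m).
  exists (wt m) => M wM; exact: tau_partial_stable (@graded_Tshift n) wM wN.
have [K HK] := @epsilon_spec _ (inhabits 0) P (ex_intro _ _ PN).
have [L HL] := PN.
by rewrite -(HK (maxn K L) (leq_maxl _ _)) (HL (maxn K L) (leq_maxr _ _)).
Qed.

(** Congruence modulo terms of weight above N, compatible with products because weights add and are
    nonnegative. *)
Definition agree N (f g : ser) := forall m, (wt m <= N)%N -> f m = g m.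

Lemma agreeD N f g f' g' : agree N f f' -> agree N g g' -> agree N (f + g) (f' + g').
Proof. by move=> H K m le; rewrite !serD H ?K. Qed.
Lemma agreeN N f f' : agree N f f' -> agree N (- f) (- f').
Proof. by move=> H m le; rewrite !serN H. Qed.
Lemma agreeM N f g f' g' : agree N f f' -> agree N g g' -> agree N (f * g) (f' * g').
Proof.
move=> H K m le; rewrite !serM; apply: eq_big_seq => d /mem_divs dm.
by have := wt_split dm => E; rewrite H ?K //; lia.
Qed.

Definition alpha3 (n : Avec) (a b c : int) : Avec :=
  aadd (aadd (aadd n (alpha a)) (alpha b)) (alpha c).

Definition tau3 pi n (a b c : int) : ser :=
  vdm3 (xs a) (xs b) (xs c) * tau_shift pi (alpha3 n a b c).

Lemma tau3_plucker pi n a b c d e g : plucker pi ->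
  tau3 pi n a b c * tau3 pi n d e g - tau3 pi n a b d * tau3 pi n c e g
  + tau3 pi n a b e * tau3 pi n c d g - tau3 pi n a b g * tau3 pi n c d e = 0.
Proof.
move=> Pl; apply: serP => m; rewrite ser0.
(* The side [wt m] + 3 is large enough for the coefficients up to weight [wt m] and leaves room for
   three columns. *)
pose f a b c : ser := vdm3 (xs a) (xs b) (xs c) *
   tau_partial pi (Tshift (alpha3 n a b c)) (wt m).+3.
have ag x y z : agree (wt m) (tau3 pi n x y z) (f x y z).
  apply: agreeM => // m' le; apply: tau_shiftE; lia.
transitivity ((f a b c * f d e g - f a b d * f c e g
  + f a b e * f c d g - f a b g * f c d e) m).
  apply: (@agreeD (wt m)) => //.
    apply: agreeD; last exact: agreeM.
    by apply: agreeD; [apply: agreeM | apply: agreeN; apply: agreeM].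
  by apply: agreeN; apply: agreeM.
rewrite /f /alpha3 !Tshift_alpha.
have := tau_partial_plucker (Tshift n) (wt m) (xs a) (xs b) (xs c) (xs d) (xs e) (xs g) Pl.
by cbv beta zeta => ->; rewrite ser0.
Qed.

(** * Values in the localization *)

Lemma alpha3E n a b c x :
  alpha3 n a b c x = n x + (x == a)%:Z + (x == b)%:Z + (x == c)%:Z.
Proof. by rewrite !aaddE !alphaE. Qed.

Lemma vdm3_swap12 x y z : vdm3 y x z = - vdm3 x y z.
Proof. by rewrite /vdm3; ring. Qed.
Lemma vdm3_swap23 x y z : vdm3 x z y = - vdm3 x y z.
Proof. by rewrite /vdm3; ring. Qed.

Lemma tau3_swap12 pi n a b c : tau3 pi n b a c = - tau3 pi n a b c.
Proof.
rewrite /tau3; have -> : alpha3 n b a c = alpha3 n a b c.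
  by apply/fsfunP => x; rewrite !alpha3E; ring.
by rewrite vdm3_swap12 mulNr.
Qed.

Lemma tau3_swap23 pi n a b c : tau3 pi n a c b = - tau3 pi n a b c.
Proof.
rewrite /tau3; have -> : alpha3 n a c b = alpha3 n a b c.
  by apply/fsfunP => x; rewrite !alpha3E; ring.
by rewrite vdm3_swap23 mulNr.
Qed.

Lemma tau3_diag13 pi n a b : tau3 pi n a b a = 0.
Proof. by rewrite /tau3 /vdm3 subrr mulr0 !mul0r. Qed.

Definition xd (p : int * int) : ser := xs p.1 - xs p.2.

Lemma denE D : den D = \prod_(p <- D) xd p.
Proof. by rewrite /den sprodE big_map; apply: eq_bigr => p _; rewrite xdiffE. Qed.

Lemma den_cat D E : den (D ++ E) = den D * den E.
Proof. by rewrite !denE big_cat. Qed.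

Lemma den_flatten (l : seq (int * int)) (P : pred (int * int)) (g : int * int -> nat) :
  den (flatten [seq nseq (g p) p | p <- l & P p]) = \prod_(p <- l | P p) xd p ^+ g p.
Proof.
rewrite denE; elim: l => [|p l IH]; first by rewrite !big_nil.
rewrite big_cons /=; case: (P p) => //=.
by rewrite big_cat IH big_nseq iter_mulr_1.
Qed.

Section Represent.
Variable U : seq (int * int).
Hypothesis U_neq : all (fun p => p.1 != p.2) U.

(* The fraction x has the value f / (den U)^w. *)
Definition rep w (x : Defs.frac) (f : ser) := den U ^+ w * x.1 = f * den x.2.

Lemma repM v w x y f g : rep v x f -> rep w y g -> rep (v + w) (fmul x y) (f * g).
Proof.
rewrite /rep /= den_cat exprD => E F.
change (smul x.1 y.1) with (x.1 * y.1).
by rewrite mulrACA E F mulrACA.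
Qed.

(** Equality of the weights stays a separate premise, to be settled once both are known. *)
Lemma repD v w x y f g : rep v x f -> rep w y g -> v = w -> rep v (fadd x y) (f + g).
Proof.
move=> E F vw; move: E F; rewrite vw /rep /= den_cat => E F.
change (sadd (smul x.1 (den y.2)) (smul y.1 (den x.2))) with
  (x.1 * den y.2 + y.1 * den x.2).
by rewrite mulrDr !mulrA E F !mulrDl [X in _ + X]mulrAC.
Qed.

Lemma repN w x f : rep w x f -> rep w (fopp x) (- f).
Proof.
rewrite /rep /= => E; change (sopp x.1) with (- x.1).
by rewrite mulrN E mulNr.
Qed.

(** Multiplication by w copies of [U] already annihilates the difference, so nothing has to be
    cancelled. *)
Lemma rep_loc_eq v w x y f g :
  rep v x f -> rep w y g -> v = w -> f = g -> loc_eq x y.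
Proof.
move=> E F vw fg; rewrite {}vw in E; exists (flatten (nseq w U)); split.
  by elim: w {E F} => //= w IH; rewrite all_cat U_neq.
have -> : den (flatten (nseq w U)) = den U ^+ w.
  elim: w {E F} => [|w IH]; first by rewrite denE big_nil.
  by rewrite [flatten _]/= den_cat IH exprS.
change (den U ^+ w * (x.1 * den y.2 - y.1 * den x.2) = 0).
by rewrite mulrBr !mulrA E F fg mulrAC subrr.
Qed.

End Represent.

(** * Products of differences over a fixed index set *)

Lemma mem_square (s : seq int) (p : int * int) :
  (p \in [seq (a, b) | a <- s, b <- s]) = (p.1 \in s) && (p.2 \in s).
Proof.
case: p => a b; apply/allpairsP/andP => [[[x y] /= [xs ys [-> ->]]] //|[aS bS]].
by exists (a, b).
Qed.

Lemma absz_norm_add (w : int) : (absz ((absz w)%:Z + w))%:Z = (absz w)%:Z + w.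
Proof. by lia. Qed.

Lemma absz_norm_add2 (u v : int) (d e : bool) :
  (absz ((absz u)%:Z + (absz v)%:Z + u * d%:Z + v * e%:Z))%:Z
  = (absz u)%:Z + (absz v)%:Z + u * d%:Z + v * e%:Z.
Proof. by case: d; case: e => /=; rewrite ?mulr0 ?mulr1 ?addr0; lia. Qed.

Section SupportedProducts.
Variable S : {fset int}.

Definition spairs : seq (int * int) :=
  [seq p <- [seq (a, b) | a <- enum_fset S, b <- enum_fset S] | p.1 < p.2].

Lemma mem_spairs p : (p \in spairs) = [&& p.1 < p.2, p.1 \in S & p.2 \in S].
Proof.
by rewrite mem_filter mem_square.
Qed.

Lemma spairs_uniq : uniq spairs.
Proof.
apply: filter_uniq; apply: allpairs_uniq; rewrite ?fset_uniq //.
by move=> [a b] [c d].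
Qed.

(** Pairs outside the support have exponent 0, so products for different exponent vectors can all be
    taken over the pairs of [S]. *)
Lemma big_supp_pairs (n : Avec) (P : pred (int * int)) (g : int * int -> nat) :
  finsupp n `<=` S -> (forall p, n p.1 * n p.2 = 0 -> g p = 0%N) ->
  \prod_(p <- supp_pairs n | P p) xd p ^+ g p
  = \prod_(p <- spairs) xd p ^+ (if P p then g p else 0%N).
Proof.
move=> sub g0; pose T p := (p.1 \in finsupp n) && (p.2 \in finsupp n).
have mem q : (q \in supp_pairs n) = [&& q.1 < q.2, q.1 \in finsupp n & q.2 \in finsupp n].
  rewrite /supp_pairs (eq_map (g := id)) ?map_id; last by case.
  by rewrite mem_filter mem_square.
have uq : uniq (supp_pairs n).
  rewrite /supp_pairs (eq_map (g := id)) ?map_id; last by case.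
  apply: filter_uniq; apply: allpairs_uniq; rewrite ?fset_uniq //.
  by move=> [a b] [c d].
rewrite (perm_big [seq p <- spairs | T p]) /=; last first.
  apply: uniq_perm => [||q]; [exact: uq | exact/filter_uniq/spairs_uniq |].
  rewrite mem mem_filter mem_spairs /T.
  case: (boolP (q.1 \in finsupp n)) => [/(fsubsetP sub) ->|]; last by rewrite andbF.
  case: (boolP (q.2 \in finsupp n)) => [/(fsubsetP sub) ->|]; last by rewrite !andbF.
  by rewrite andbT.
rewrite big_filter_cond big_mkcond; apply: eq_bigr => p _.
case: (P p); rewrite ?andbF ?andbT // /T; case: ifP => // /negbT nT.
rewrite g0 //; move: nT; rewrite negb_and !memNfinsupp.
by case/orP => /eqP ->; rewrite ?mul0r ?mulr0.
Qed.

Definition xprod (g : int * int -> nat) : ser := \prod_(p <- spairs) xd p ^+ g p.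

Lemma xprodD g h : xprod (fun p => g p + h p)%N = xprod g * xprod h.
Proof. by rewrite /xprod -big_split; apply: eq_bigr => p _; rewrite exprD. Qed.

Lemma eq_xprod g h : (forall p, p \in spairs -> g p = h p) -> xprod g = xprod h.
Proof. by move=> E; apply: eq_big_seq => p /E ->. Qed.

Lemma xprod_delta q : q \in spairs -> xprod (fun p => (p == q)) = xd q.
Proof.
move=> qS; rewrite /xprod (bigD1_seq q) ?spairs_uniq //= eqxx expr1 big1 ?mulr1 //.
by move=> p /negbTE ->.
Qed.

Variable n0 : Avec.
Hypothesis n0S : finsupp n0 `<=` S.

(** Let d be the indicator of {a, b, c}. The exponent (n0+d)_p (n0+d)_q splits into n0_p n0_q (in
    [expK]), the linear part n0_p d_q + n0_q d_p (in [expX] at a, b and c) and d_p d_q. Added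
    absolute values keep [expK] and the three [expX] nonnegative; [exp0] is the total added, which
    explains the 3. *)
Definition exp0 (p : int * int) : nat :=
  (absz (n0 p.1 * n0 p.2)%R + 3 * (absz (n0 p.1) + absz (n0 p.2)))%N.
Definition expK (p : int * int) : nat :=
  absz ((absz (n0 p.1 * n0 p.2))%:Z + n0 p.1 * n0 p.2).
Definition expX (a : int) (p : int * int) : nat :=
  absz ((absz (n0 p.1))%:Z + (absz (n0 p.2))%:Z
        + n0 p.1 * (p.2 == a)%:Z + n0 p.2 * (p.1 == a)%:Z).

Lemma exponents (a b c : int) (p : int * int) :
  a < b -> b < c -> p.1 < p.2 ->
  let n := alpha3 n0 a b c in let t := n p.1 * n p.2 in
  (exp0 p + (if (0 <= t)%R then absz t else 0) =
   expK p + expX a p + expX b p + expX c p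
   + ((p == (a, b)) + (p == (a, c)) + (p == (b, c)))
   + (if (t < 0)%R then absz t else 0))%N.
Proof.
move=> ab bc; case: p => p q /= pq; rewrite /exp0 /expK /expX /= !alpha3E !xpair_eqE.
(* For p < q the quadratic part is 1 exactly at (a,b), (a,c) and (b,c), the three factors of
   [vdm3]. *)
have ind : ((p == a)%:Z + (p == b)%:Z + (p == c)%:Z)
    * ((q == a)%:Z + (q == b)%:Z + (q == c)%:Z) =
    (((p == a) && (q == b)) + ((p == a) && (q == c)) + ((p == b) && (q == c)))%N%:Z.
  have [?|_] := eqVneq p a; have [?|_] := eqVneq p b; have [?|_] := eqVneq p c;
  have [?|_] := eqVneq q a; have [?|_] := eqVneq q b; have [?|_] := eqVneq q c;
  by lia.
move: (n0 p) (n0 q) ind => u v.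
move: (_ + _ + _)%N => s; set dp := _ + _ + (p == c)%:Z; set dq := _ + _ + (q == c)%:Z.
move=> ind.
have K := absz_norm_add (u * v).
have X d := absz_norm_add2 u v (q == d) (p == d).
have E : (u + (p == a)%:Z + (p == b)%:Z + (p == c)%:Z) *
         (v + (q == a)%:Z + (q == b)%:Z + (q == c)%:Z) =
         u * v + u * dq + v * dp + s%:Z.
  by rewrite -ind /dp /dq; ring.
have Eq : u * dq = u * (q == a)%:Z + u * (q == b)%:Z + u * (q == c)%:Z.
  by rewrite /dq; ring.
have Ep : v * dp = v * (p == a)%:Z + v * (p == b)%:Z + v * (p == c)%:Z.
  by rewrite /dp; ring.
rewrite E Eq Ep; set xa := absz (_ + u * (q == a)%:Z + _).
set xb := absz (_ + u * (q == b)%:Z + _); set xc := absz (_ + u * (q == c)%:Z + _).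
set k := absz (_ + u * v).
move: (X a) (X b) (X c) K; clear X E Eq Ep ind; rewrite -/xa -/xb -/xc -/k.
move: xa xb xc k => xa xb xc k.
move: (u * v) => w; move: (u * (q == a)%:Z) (u * (q == b)%:Z) (u * (q == c)%:Z) => ua ub uc.
move: (v * (p == a)%:Z) (v * (p == b)%:Z) (v * (p == c)%:Z) => va vb vc Xa Xb Xc K.
by case: leP; lia.
Qed.

(** The common denominator: [exp0] depends on [n0] but not on a, b, c. *)
Definition baseU : seq (int * int) := flatten [seq nseq (exp0 p) p | p <- spairs & true].

Lemma den_baseU : den baseU = xprod exp0.
Proof. by rewrite den_flatten. Qed.

Lemma baseU_neq : all (fun p => p.1 != p.2) baseU.
Proof.
apply/allP => q /flattenP [s /mapP [p]]; rewrite mem_filter mem_spairs /=.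
by case/andP => lt _ ->; rewrite mem_nseq => /andP [_ /eqP ->]; rewrite lt_eqF.
Qed.

Definition tauK pi a b c : ser :=
  xprod expK * xprod (expX a) * xprod (expX b) * xprod (expX c) * tau3 pi n0 a b c.

Lemma rep_Hn pi a b c n : n = alpha3 n0 a b c -> a < b -> b < c ->
  a \in S -> b \in S -> c \in S -> rep baseU 1 (Hn pi n) (tauK pi a b c).
Proof.
move=> nE ab bc aS bS cS; rewrite /rep /Hn /= expr1 sprodE big_map big_filter.
rewrite den_flatten den_baseU.
have nS : finsupp n `<=` S.
  apply/fsubsetP => x; rewrite nE mem_finsupp alpha3E.
  have [->|_] := eqVneq x a; first by [].
  have [->|_] := eqVneq x b; first by [].
  have [->|_] := eqVneq x c; first by [].
  by rewrite !addr0 -mem_finsupp => /(fsubsetP n0S).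
under eq_bigr do rewrite spowE xdiffE -/(xd _).
have g0 p : n p.1 * n p.2 = 0 -> absz (n p.1 * n p.2) = 0%N by move=> ->.
rewrite !(big_supp_pairs _ nS g0) -!/(xprod _).
have smulE f g : smul f g = f * g by [].
rewrite smulE.
rewrite mulrA -xprodD.
have -> : xprod (fun p => exp0 p + (if (0 <= n p.1 * n p.2)%R then absz (n p.1 * n p.2)%R else 0))%N
  = xprod (fun p => expK p + expX a p + expX b p + expX c p
   + ((p == (a, b)) + (p == (a, c)) + (p == (b, c)))
   + (if (n p.1 * n p.2 < 0)%R then absz (n p.1 * n p.2)%R else 0))%N.
  apply: eq_xprod => p; rewrite mem_spairs => /andP [lt _].
  by rewrite nE; apply: exponents.
rewrite !xprodD !xprod_delta ?mem_spairs ?aS ?bS ?cS ?ab ?bc ?(lt_trans ab bc) //.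
have comm (u v w : ser) : u * v * w = u * w * v by rewrite mulrAC.
by rewrite /tauK /tau3 -nE /vdm3 comm [in RHS]mulrA.
Qed.
End SupportedProducts.

(** * Minors of a 3 x 3 matrix of hooks *)

Section PlueckerThree.
Variables (R : comNzRingType) (T : Type) (f : T -> T -> T -> R).
Hypothesis swap12 : forall a b c, f b a c = - f a b c.
Hypothesis swap23 : forall a b c, f a c b = - f a b c.
Hypothesis diag13 : forall a b, f a b a = 0.
Hypothesis plucker4 : forall a b c d e g,
  f a b c * f d e g - f a b d * f c e g + f a b e * f c d g - f a b g * f c d e = 0.

(** The shared index r kills one of the four terms by [diag13], leaving a three-term relation. *)
Lemma plucker_two r p q s t :
  f r q p * f r t s = f r t p * f r q s - f r t q * f r p s.
Proof.
have := plucker4 r p q r s t; rewrite diag13 mul0r subr0.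
rewrite (swap12 r q) (swap23 r p q) (swap23 r p t) (swap12 r q s).
rewrite (swap23 r t s) (swap23 r q t) => E.
apply/eqP; rewrite -subr_eq0 -[X in _ == X]E; apply/eqP.
rewrite (swap23 r t p) (swap23 r q p) (swap23 r t q); ring.
Qed.

Variables y1 y2 y3 : T.

(** The matrix entry in row x and column b is [f] with y_b deleted from (y3, y2, y1) and x appended.
    This is the minor on rows t, s and columns 1, 2; the next two lemmas treat the other pairs of
    columns. *)
Lemma minor12 t s :
  f y3 y2 y1 * f y3 t s = f y3 y2 t * f y3 y1 s - f y3 y1 t * f y3 y2 s.
Proof. by rewrite plucker_two (swap23 y3 t y1) (swap23 y3 t y2); ring. Qed.

Lemma minor13 t s :
  f y3 y2 y1 * f y2 t s = f y3 y2 t * f y2 y1 s - f y2 y1 t * f y3 y2 s.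
Proof.
have := plucker_two y2 y1 y3 s t.
rewrite (swap12 y3 y2 y1) (swap23 y2 y1 t) (swap12 y3 y2 s) (swap23 y2 y3 t) (swap12 y3 y2 t).
by rewrite mulNr => /eqP; rewrite eqr_oppLR => /eqP ->; ring.
Qed.

Lemma minor23 t s :
  f y3 y2 y1 * f y1 t s = f y3 y1 t * f y2 y1 s - f y2 y1 t * f y3 y1 s.
Proof.
have := plucker_two y1 y2 y3 s t.
rewrite (swap12 y3 y1 y2) (swap23 y3 y2 y1) (swap23 y1 y2 t) (swap12 y2 y1 t).
rewrite (swap12 y3 y1 s) (swap23 y1 y3 t) (swap12 y3 y1 t) (swap12 y2 y1 s).
by rewrite opprK => ->; ring.
Qed.

(** Laplace expansion along row x1: the second factors are the minors on rows x2, x3 of the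
    preceding lemmas. *)
Lemma minor123 x1 x2 x3 :
  f y3 y2 y1 * f x1 x2 x3 =
  f y3 y2 x1 * f y1 x2 x3 - f y3 y1 x1 * f y2 x2 x3 + f y2 y1 x1 * f y3 x2 x3.
Proof.
have cyc a b c : f a b c = f b c a by rewrite swap12 swap23 opprK.
have := plucker4 x2 x3 x1 y1 y2 y3.
rewrite -(cyc x1 x2 x3) (cyc x1 y2 y3) (cyc x1 y1 y3) (cyc x1 y1 y2).
rewrite -(cyc y1 x2 x3) -(cyc y2 x2 x3) -(cyc y3 x2 x3).
rewrite (cyc y1 y2 y3) (swap12 y3 y2 y1) (swap12 y3 y2 x1) (swap12 y3 y1 x1) (swap12 y2 y1 x1).
by move=> E; apply/eqP; rewrite -subr_eq0 -oppr_eq0 -[X in _ == X]E; apply/eqP; ring.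
Qed.
End PlueckerThree.

(** For the first six, a minor is multiplied by an off-diagonal entry and g_ab g_ba is replaced by
    g_aa g_bb - h m_ab. For the last, h^2 d is the determinant, which the same replacement turns
    into X + XT - 2P + h (g11 m23 + g22 m13 + g33 m12). Multiplying by X leaves X XT, the product of
    the three g_ab g_ba, so XT disappears. *)
Lemma principal_minor_identities (R : comNzRingType)
  (h g11 g12 g13 g21 g22 g23 g31 g32 g33 m12 m13 m23 : R)
  (a1 a1' a2 a2' a3 a3' d : R) :
  h * m12 = g11 * g22 - g12 * g21 ->
  h * m13 = g11 * g33 - g13 * g31 ->
  h * m23 = g22 * g33 - g23 * g32 ->
  h * a1 = g11 * g32 - g12 * g31 ->
  h * a1' = g11 * g23 - g13 * g21 ->
  h * a2 = g12 * g23 - g13 * g22 ->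
  h * a2' = g21 * g32 - g22 * g31 ->
  h * a3 = g21 * g33 - g23 * g31 ->
  h * a3' = g12 * g33 - g13 * g32 ->
  h * d = g11 * m23 - g12 * a3 + g13 * a2' ->
  let P := g11 * g22 * g33 in
  let X := g12 * g23 * g31 in
  let XT := g21 * g32 * g13 in
  [/\ h * g23 * a1 = - (h * g11 * m23) + P - X,
      h * g31 * a2 = h * g22 * m13 - P + X,
      h * g12 * a3 = - (h * g33 * m12) + P - X &
   [/\ h * g32 * a1' = - (h * g11 * m23) + P - XT,
      h * g13 * a2' = h * g22 * m13 - P + XT,
      h * g21 * a3' = - (h * g33 * m12) + P - XT &
      h * h * X * d = X * X
        - X * (P + P - h * (g11 * m23 + g22 * m13 + g33 * m12))
        + (g11 * g22 - h * m12) * (g11 * g33 - h * m13) * (g22 * g33 - h * m23)]].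
Proof.
move=> e12 e13 e23 b1 b1' b2 b2' b3 b3' ed P X XT.
have ac x y z : x * y * z = y * (x * z) :> R by ring.
do ![split].
- by rewrite !ac b1 e23 /P /X; ring.
- by rewrite !ac b2 e13 /P /X; ring.
- by rewrite !ac b3 e12 /P /X; ring.
- by rewrite !ac b1' e23 /P /XT; ring.
- by rewrite !ac b2' e13 /P /XT; ring.
- by rewrite !ac b3' e12 /P /XT; ring.
have -> : h * h * X * d = X * (h * (h * d)) by ring.
have -> : h * (h * d) = g11 * (h * m23) - g12 * (h * a3) + g13 * (h * a2').
  by rewrite ed; ring.
have -> : h * (g11 * m23 + g22 * m13 + g33 * m12) =
  g11 * (h * m23) + g22 * (h * m13) + g33 * (h * m12) by ring.
by rewrite e12 e13 e23 b3 b2' /P /X; ring.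
Qed.

Section TauK.
Variables (S : {fset int}) (n0 : Avec) (pi : seq nat -> C).

Lemma tauK_swap12 a b c : tauK S n0 pi b a c = - tauK S n0 pi a b c.
Proof.
rewrite /tauK tau3_swap12.
move: (xprod _ _) (xprod _ _) (xprod _ _) (xprod _ _) (tau3 _ _ _ _ _) => k u v w t; ring.
Qed.

Lemma tauK_swap23 a b c : tauK S n0 pi a c b = - tauK S n0 pi a b c.
Proof.
rewrite /tauK tau3_swap23.
move: (xprod _ _) (xprod _ _) (xprod _ _) (xprod _ _) (tau3 _ _ _ _ _) => k u v w t; ring.
Qed.

Lemma tauK_diag13 a b : tauK S n0 pi a b a = 0.
Proof. by rewrite /tauK tau3_diag13 mulr0. Qed.

(** Each term uses every one of the six indices once, so all terms carry the same factor [q]. *)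
Lemma tauK_plucker (Pl : plucker pi) a b c d e g :
  tauK S n0 pi a b c * tauK S n0 pi d e g - tauK S n0 pi a b d * tauK S n0 pi c e g
  + tauK S n0 pi a b e * tauK S n0 pi c d g - tauK S n0 pi a b g * tauK S n0 pi c d e = 0.
Proof.
pose q : ser := xprod S (expK n0) ^+ 2 * (xprod S (expX n0 a) * xprod S (expX n0 b)
  * xprod S (expX n0 c)) * (xprod S (expX n0 d) * xprod S (expX n0 e) * xprod S (expX n0 g)).
rewrite -[RHS](mulr0 q) -(tau3_plucker n0 a b c d e g Pl) /q /tauK.
move: (xprod S (expK n0)) (xprod S (expX n0 a)) (xprod S (expX n0 b)) (xprod S (expX n0 c))
  (xprod S (expX n0 d)) (xprod S (expX n0 e)) (xprod S (expX n0 g)) => k va vb vc vd ve vg.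
move: (tau3 pi n0 a b c) (tau3 pi n0 d e g) (tau3 pi n0 a b d) (tau3 pi n0 c e g)
  (tau3 pi n0 a b e) (tau3 pi n0 c d g) (tau3 pi n0 a b g) (tau3 pi n0 c d e)
  => t1 t2 t3 t4 t5 t6 t7 t8.
by ring.
Qed.
End TauK.

(** * Transfer of the matrix identities to the localization *)

Lemma gammaE p x : gamma p x = (x == p%:Z)%:Z - (x == - p%:Z - 1)%:Z.
Proof. by rewrite /gamma aaddE aoppE !alphaE. Qed.

Local Notation hookvec p q n :=
  (aadd (alpha p%:Z) (aadd (aopp (alpha (- q%:Z - 1)%R)) n)).

Lemma HhookE pi n p q :
  Hhook pi n p q = Hn pi (hookvec p q n).
Proof. by []. Qed.

Ltac match_vectors n0E := let x := fresh in
  move=> x; rewrite alpha3E n0E !(aaddE, aoppE, alphaE, gammaE); ring.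

(** The ring identity [I] fixes the two numerators; the fractions are then decomposed in parallel
    with them. The weights count factors H, so their equations hold by computation. *)
Ltac represent L M D N I := eapply L; last exact: I;
  repeat lazymatch goal with
  | |- _ _ (fmul _ _) _ => eapply M
  | |- _ _ (fadd _ _) _ => eapply D
  | |- _ _ (fopp _) _ => eapply N
  | |- _ = _ => reflexivity
  | |- _ => eassumption
  end.

Local Open Scope loc_scope.

Theorem mainTheorem10 (pi : seq nat -> C) (hw : is_point pi)
  (n' : Avec) (hn' : inB n') (i j k : nat) (hij : (i < j)%N) (hjk : (j < k)%N) :
  let H := Hn pi n' in
  let Hv (v : Avec) := Hn pi (aadd n' v) in
  let Hk (p q : nat) := Hhook pi n' p q in
  let Hkv (v : Avec) (p q : nat) := Hhook pi (aadd n' v) p q in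
  let gi := gamma i in let gj := gamma j in let gk := gamma k in
  let P := Hv gi * Hv gj * Hv gk in
  let X := Hk i j * Hk j k * Hk k i in
  let XT := Hk j i * Hk k j * Hk i k in
  (* (1) *) H * Hk j k * Hkv gi k j =~ - (H * Hv gi * Hv (aadd gj gk)) + P - X /\
  (* (2) *) H * Hk k i * Hkv gj i k =~ H * Hv gj * Hv (aadd gi gk) - P + X /\
  (* (3) *) H * Hk i j * Hkv gk j i =~ - (H * Hv gk * Hv (aadd gi gj)) + P - X /\
  (* (4) *) H * Hk k j * Hkv gi j k =~ - (H * Hv gi * Hv (aadd gj gk)) + P - XT /\
  (* (5) *) H * Hk i k * Hkv gj k i =~ H * Hv gj * Hv (aadd gi gk) - P + XT /\
  (* (6) *) H * Hk j i * Hkv gk i j =~ - (H * Hv gk * Hv (aadd gi gj)) + P - XT /\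
  (* (7) *) H * H * X * Hv (aadd gi (aadd gj gk)) =~
            X * X
            - X * (P + P - H * (Hv gi * Hv (aadd gj gk) + Hv gj * Hv (aadd gi gk)
                                + Hv gk * Hv (aadd gi gj)))
            + (Hv gi * Hv gj - H * Hv (aadd gi gj))
              * (Hv gi * Hv gk - H * Hv (aadd gi gk))
              * (Hv gj * Hv gk - H * Hv (aadd gj gk)).
Proof.
have Pl := hw.2.
pose x1 : int := i; pose x2 : int := j; pose x3 : int := k.
pose y1 : int := (- i%:Z - 1)%R; pose y2 : int := (- j%:Z - 1)%R.
pose y3 : int := (- k%:Z - 1)%R.
pose n0 := aadd (aadd (aadd n' (aopp (alpha y3))) (aopp (alpha y2))) (aopp (alpha y1)).
pose S : {fset int} := finsupp n0 `|` [fset y3; y2; y1; x1; x2; x3].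
have n0S : finsupp n0 `<=` S by apply: fsubsetUl.
have y3S : y3 \in S by rewrite /S !inE eqxx ?orbT.
have y2S : y2 \in S by rewrite /S !inE eqxx ?orbT.
have y1S : y1 \in S by rewrite /S !inE eqxx ?orbT.
have x1S : x1 \in S by rewrite /S !inE eqxx ?orbT.
have x2S : x2 \in S by rewrite /S !inE eqxx ?orbT.
have x3S : x3 \in S by rewrite /S !inE eqxx ?orbT.
have y32 : (y3 < y2)%R by rewrite /y3 /y2; lia.
have y21 : (y2 < y1)%R by rewrite /y2 /y1; lia.
have yx : (y1 < x1)%R by rewrite /y1 /x1; lia.
have x12 : (x1 < x2)%R by rewrite /x1 /x2; lia.
have x23 : (x2 < x3)%R by rewrite /x2 /x3; lia.
have y31 := lt_trans y32 y21.
have y1x2 := lt_trans yx x12; have y1x3 := lt_trans y1x2 x23.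
have y2x1 := lt_trans y21 yx; have y2x2 := lt_trans y21 y1x2; have y2x3 := lt_trans y21 y1x3.
have y3x1 := lt_trans y31 yx; have y3x2 := lt_trans y31 y1x2; have y3x3 := lt_trans y31 y1x3.
have x13 := lt_trans x12 x23.
pose f := tauK S n0 pi.
have repf a b c (n : Avec) : n =1 alpha3 n0 a b c -> (a < b)%R -> (b < c)%R -> a \in S -> b \in S ->
    c \in S -> rep (baseU S n0) 1 (Hn pi n) (f a b c).
  by move=> E *; apply: rep_Hn => //; apply/fsfunP.
have n0E x : n0 x = (n' x - (x == y3)%:Z - (x == y2)%:Z - (x == y1)%:Z)%R.
  by rewrite /n0 !(aaddE, aoppE, alphaE).
rewrite /= !HhookE.
have r0 : rep (baseU S n0) 1 (Hn pi n') (f y3 y2 y1).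
  by apply: repf => // x; rewrite alpha3E n0E; ring.
have g11 : rep (baseU S n0) 1 (Hn pi (aadd n' (gamma i))) (f y3 y2 x1).
  by apply: repf => //; match_vectors n0E.
have g22 : rep (baseU S n0) 1 (Hn pi (aadd n' (gamma j))) (f y3 y1 x2).
  by apply: repf => //; match_vectors n0E.
have g33 : rep (baseU S n0) 1 (Hn pi (aadd n' (gamma k))) (f y2 y1 x3).
  by apply: repf => //; match_vectors n0E.
have g12 : rep (baseU S n0) 1 (Hn pi (hookvec i j n')) (f y3 y1 x1).
  by apply: repf => //; match_vectors n0E.
have g13 : rep (baseU S n0) 1 (Hn pi (hookvec i k n')) (f y2 y1 x1).
  by apply: repf => //; match_vectors n0E.
have g21 : rep (baseU S n0) 1 (Hn pi (hookvec j i n')) (f y3 y2 x2).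
  by apply: repf => //; match_vectors n0E.
have g23 : rep (baseU S n0) 1 (Hn pi (hookvec j k n')) (f y2 y1 x2).
  by apply: repf => //; match_vectors n0E.
have g31 : rep (baseU S n0) 1 (Hn pi (hookvec k i n')) (f y3 y2 x3).
  by apply: repf => //; match_vectors n0E.
have g32 : rep (baseU S n0) 1 (Hn pi (hookvec k j n')) (f y3 y1 x3).
  by apply: repf => //; match_vectors n0E.
have m12 : rep (baseU S n0) 1 (Hn pi (aadd n' (aadd (gamma i) (gamma j)))) (f y3 x1 x2).
  by apply: repf => //; match_vectors n0E.
have m13 : rep (baseU S n0) 1 (Hn pi (aadd n' (aadd (gamma i) (gamma k)))) (f y2 x1 x3).
  by apply: repf => //; match_vectors n0E.
have m23 : rep (baseU S n0) 1 (Hn pi (aadd n' (aadd (gamma j) (gamma k)))) (f y1 x2 x3).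
  by apply: repf => //; match_vectors n0E.
have d : rep (baseU S n0) 1
    (Hn pi (aadd n' (aadd (gamma i) (aadd (gamma j) (gamma k))))) (f x1 x2 x3).
  by apply: repf => //; match_vectors n0E.
have a1 : rep (baseU S n0) 1 (Hn pi (hookvec k j (aadd n' (gamma i)))) (f y3 x1 x3).
  by apply: repf => //; match_vectors n0E.
have a1' : rep (baseU S n0) 1 (Hn pi (hookvec j k (aadd n' (gamma i)))) (f y2 x1 x2).
  by apply: repf => //; match_vectors n0E.
have a2 : rep (baseU S n0) 1 (Hn pi (hookvec i k (aadd n' (gamma j)))) (f y1 x1 x2).
  by apply: repf => //; match_vectors n0E.
have a2' : rep (baseU S n0) 1 (Hn pi (hookvec k i (aadd n' (gamma j)))) (f y3 x2 x3).
  by apply: repf => //; match_vectors n0E.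
have a3 : rep (baseU S n0) 1 (Hn pi (hookvec j i (aadd n' (gamma k)))) (f y2 x2 x3).
  by apply: repf => //; match_vectors n0E.
have a3' : rep (baseU S n0) 1 (Hn pi (hookvec i j (aadd n' (gamma k)))) (f y1 x1 x3).
  by apply: repf => //; match_vectors n0E.
have s12 := @tauK_swap12 S n0 pi; have s23 := @tauK_swap23 S n0 pi.
have dg := @tauK_diag13 S n0 pi; have p4 := @tauK_plucker S n0 pi Pl.
(* Rows are x1, x2, x3 and columns y1, y2, y3. All nine 2 x 2 minors are supplied: the three
   principal ones, the six others, and then the determinant. *)
have := principal_minor_identities (minor12 s12 s23 dg p4 y1 y2 y3 x1 x2)
  (minor13 s12 s23 dg p4 y1 y2 y3 x1 x3) (minor23 s12 s23 dg p4 y1 y2 y3 x2 x3)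
  (minor12 s12 s23 dg p4 y1 y2 y3 x1 x3) (minor13 s12 s23 dg p4 y1 y2 y3 x1 x2)
  (minor23 s12 s23 dg p4 y1 y2 y3 x1 x2) (minor12 s12 s23 dg p4 y1 y2 y3 x2 x3)
  (minor13 s12 s23 dg p4 y1 y2 y3 x2 x3) (minor23 s12 s23 dg p4 y1 y2 y3 x1 x3)
  (minor123 s12 s23 p4 y1 y2 y3 x1 x2 x3).
rewrite -/f; cbv zeta; clearbody f => -[I1 I2 I3 [I4 I5 I6 I7]].
have L := @rep_loc_eq _ (@baseU_neq S n0); have M := @repM (baseU S n0).
have D := @repD (baseU S n0); have N := @repN (baseU S n0).
clear repf.
(* Forget the vectors and [rep]: unification would otherwise unfold them. *)
move: L M D N r0 g11 g22 g33 g12 g13 g21 g23 g31 g32 m12 m13 m23 d a1 a1' a2 a2' a3 a3'.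
generalize (rep (baseU S n0))
  (Hn pi n')
  (Hn pi (aadd n' (gamma i)))
  (Hn pi (aadd n' (gamma j)))
  (Hn pi (aadd n' (gamma k)))
  (Hn pi (hookvec i j n'))
  (Hn pi (hookvec i k n'))
  (Hn pi (hookvec j i n'))
  (Hn pi (hookvec j k n'))
  (Hn pi (hookvec k i n'))
  (Hn pi (hookvec k j n'))
  (Hn pi (aadd n' (aadd (gamma i) (gamma j))))
  (Hn pi (aadd n' (aadd (gamma i) (gamma k))))
  (Hn pi (aadd n' (aadd (gamma j) (gamma k))))
  (Hn pi (aadd n' (aadd (gamma i) (aadd (gamma j) (gamma k)))))
  (Hn pi (hookvec k j (aadd n' (gamma i))))
  (Hn pi (hookvec j k (aadd n' (gamma i))))
  (Hn pi (hookvec i k (aadd n' (gamma j))))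
  (Hn pi (hookvec k i (aadd n' (gamma j))))
  (Hn pi (hookvec j i (aadd n' (gamma k))))
  (Hn pi (hookvec i j (aadd n' (gamma k)))).
move=> rp Fr0 Fg11 Fg22 Fg33 Fg12 Fg13 Fg21 Fg23 Fg31 Fg32 Fm12 Fm13 Fm23 Fd
  Fa1 Fa1' Fa2 Fa2' Fa3 Fa3'.
move=> L M D N r0 g11 g22 g33 g12 g13 g21 g23 g31 g32 m12 m13 m23 d a1 a1' a2 a2' a3 a3'.
do ![split].
- by represent L M D N I1.
- by represent L M D N I2.
- by represent L M D N I3.
- by represent L M D N I4.
- by represent L M D N I5.
- by represent L M D N I6.
- by represent L M D N I7.
Qed.
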